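(* For integers $\ell>1$, $m>1$, $k\ge1$ define \[ \sum_{n=0}^{\infty}\delta_{m;k}(n)q^n=\frac{f_1^k}{f_m^k},\qquad \sum_{n=0}^{\infty}\delta_{\ell,m;k}(n)q^n=\frac{f_1^k f_{\ell}^k}{f_m^k f_{\ell m}^k}, \] and let $\delta'_{m;k}(n)$, $\delta'_{\ell,m;k}(n)$ denote the coefficients of $q^n$ in the reciprocals $f_m^k/f_1^k$ and $f_m^kf_{\ell m}^k/(f_1^kf_\ell^k)$ respectively. Then for all $n\ge0$: $\delta_{3;3}(3n+1)=-3\delta_{3;3}'(n)$; $\delta_{3;6}(3n+2)=9\delta_{3;6}'(n)$; $\delta_{5;2}(5n+2)=-\delta_{5;2}'(n)$; $\delta_{5;3}(5n+3)=5\delta_{5;3}'(n)$; $\delta_{5;4}(5n+4)=-5\delta_{5;4}'(n)$; $\delta_{5;8}(5n+3)=-125\delta_{5;8}'(n)$; $\delta_{7;2}(7n+4)=\delta_{7;2}'(n)$; $\delta_{7;3}(7n+6)=-7\delta_{7;3}'(n)$; $\delta_{7;6}(7n+12)=49\delta_{7;6}'(n)$; $\delta_{11;2}(11n+10)=\delta_{11;2}'(n)$; $\delta_{2,3;1}(3n+1)=-\delta_{2,3;1}'(n)$; $\delta_{2,3;2}(3n+2)=-3\delta_{2,3;2}'(n)$; $\delta_{2,3;5}(3n+5)=-81\delta_{2,3;5}'(n)$; $\delta_{2,5;1}(5n+3)=\delta_{2,5;1}'(n)$; $\delta_{2,5;3}(5n+9)=25\delta_{2,5;3}'(n)$; $\delta_{3,5;1}(5n+4)=\delta_{3,5;1}'(n)$;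 $\delta_{3,5;2}(5n+8)=-5\delta_{3,5;2}'(n)$; $\delta_{3,5;3}(5n+12)=25\delta_{3,5;3}'(n)$; $\delta_{2,7;1}(7n+6)=\delta_{2,7;1}'(n)$; $\delta_{4,7;1}(7n+10)=\delta_{4,7;1}'(n)$; $\delta_{3,11;1}(11n+20)=\delta_{3,11;1}'(n)$; $\delta_{4,11;1}(11n+25)=\delta_{4,11;1}'(n)$.
   Context: $f_n:=(q^n;q^n)_\infty=\prod_{j\ge1}(1-q^{nj})$, where $q$ is a formal variable (or complex with $|q|<1$).
   Formalization: The sixth identity is proved as δ_{5;8}(5n+8) = −125 δ'_{5;8}(n); with 5n+3 as printed it fails at n = 0, where the left side is 0 and the right side is −125. *)

(* Defs.v *)
From HB Require Import structures.
From mathcomp Require Import all_boot all_algebra.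
From mathcomp Require Import boolp.

Set Implicit Arguments.
Unset Strict Implicit.
Unset Printing Implicit Defensive.

Import GRing.Theory.
Local Open Scope ring_scope.

(* The formal power series \sum_n (coefs a n) q^n over R. *)
Record fps (R : Type) := FPS { coefs : nat -> R }.

Section FpsRing.
Variable R : comUnitRingType.
Implicit Types a b c : fps R.

Lemma fpsP a b : coefs a =1 coefs b -> a = b.
Proof. by case: a b => [a] [b] /= /funext ->. Qed.

(* Equality of series is not decidable, hence the classical instances. *)
HB.instance Definition _ := gen_eqMixin (fps R).
HB.instance Definition _ := gen_choiceMixin (fps R).

Definition fps_zero : fps R := FPS (fun=> 0).
Definition fps_one : fps R := FPS (fun n => (n == 0%N)%:R).
Definition fps_opp a : fps R := FPS (fun n => - coefs a n).
Definition fps_add a b : fps R := FPS (fun n => coefs a n + coefs b n).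
Definition fps_mul a b : fps R :=
  FPS (fun n => \sum_(i < n.+1) coefs a i * coefs b (n - i)).

Lemma fps_addA : associative fps_add.
Proof. by move=> a b c; apply: fpsP => n /=; rewrite addrA. Qed.
Lemma fps_addC : commutative fps_add.
Proof. by move=> a b; apply: fpsP => n /=; rewrite addrC. Qed.
Lemma fps_add0 : left_id fps_zero fps_add.
Proof. by move=> a; apply: fpsP => n /=; rewrite add0r. Qed.
Lemma fps_addN : left_inverse fps_zero fps_opp fps_add.
Proof. by move=> a; apply: fpsP => n /=; rewrite addNr. Qed.

HB.instance Definition _ :=
  GRing.isZmodule.Build (fps R) fps_addA fps_addC fps_add0 fps_addN.

Definition fps_trunc N a : {poly R} := \poly_(i < N.+1) coefs a i.

Lemma coef_fps_mul_trunc a b n N : (n <= N)%N ->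
  coefs (fps_mul a b) n = (fps_trunc N a * fps_trunc N b)`_n.
Proof.
move=> nN; rewrite coefM; apply: eq_bigr => i _.
rewrite !coef_poly !ltnS (leq_trans _ nN) ?(leq_trans (leq_subr _ _) nN) //.
by rewrite -ltnS ltn_ord.
Qed.

Lemma fps_mulA : associative fps_mul.
Proof.
move=> a b c; apply: fpsP => n.
have eql p (u v w : {poly R}) : (forall i, (i <= p)%N -> u`_i = v`_i) ->
    (u * w)`_p = (v * w)`_p.
  by move=> uv; rewrite !coefM; apply: eq_bigr => i _; rewrite uv // -ltnS.
have truncM d e i : (i <= n)%N ->
    (fps_trunc n (fps_mul d e))`_i = (fps_trunc n d * fps_trunc n e)`_i.
  by move=> le_in; rewrite coef_poly ltnS le_in (coef_fps_mul_trunc d e le_in).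
rewrite !(@coef_fps_mul_trunc _ _ n n) // [fps_trunc n a * _]mulrC.
rewrite (eql n _ _ _ (truncM b c)) (eql n _ _ _ (truncM a b)).
by rewrite [_ * fps_trunc n a]mulrC mulrA.
Qed.

Lemma fps_mulC : commutative fps_mul.
Proof.
by move=> a b; apply: fpsP => n; rewrite !(@coef_fps_mul_trunc _ _ n n) // mulrC.
Qed.

Lemma fps_mul1 : left_id fps_one fps_mul.
Proof.
move=> a; apply: fpsP => n /=; rewrite big_ord_recl /= mul1r subn0.
by rewrite big1 ?addr0 // => i _; rewrite mul0r.
Qed.

Lemma fps_mulDl : left_distributive fps_mul fps_add.
Proof.
move=> a b c; apply: fpsP => n /=; rewrite -big_split /=.
by apply: eq_bigr => i _; rewrite mulrDl.
Qed.

Lemma fps_one_neq0 : fps_one != 0 :> fps R.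
Proof.
apply/eqP => /(congr1 (fun a : fps R => coefs a 0)) /= /eqP.
by rewrite oner_eq0.
Qed.

HB.instance Definition _ := GRing.Zmodule_isComNzRing.Build (fps R)
  fps_mulA fps_mulC fps_mul1 fps_mulDl fps_one_neq0.

Definition fps_unit : {pred fps R} :=
  fun a => coefs a 0 \is a GRing.unit.

(* The coefficients b_0, ..., b_n of 1/a, from b_0 = a_0^-1 and
   b_{n+1} = - a_0^-1 \sum_{i <= n} a_{i+1} b_{n-i}. *)
Fixpoint fps_inv_prefix a n : seq R :=
  if n is n'.+1 then
    let s := fps_inv_prefix a n' in
    rcons s (- (coefs a 0)^-1 * \sum_(i < n) coefs a i.+1 * s`_(n' - i))
  else [:: (coefs a 0)^-1].

(* As usual in MathComp, the inverse of a non-unit is itself. *)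
Definition fps_inv a : fps R :=
  if fps_unit a then FPS (fun n => (fps_inv_prefix a n)`_n) else a.

Lemma size_fps_inv_prefix a n : size (fps_inv_prefix a n) = n.+1.
Proof. by elim: n => //= n IHn; rewrite size_rcons IHn. Qed.

Lemma nth_fps_inv_prefix a n i : (i <= n)%N ->
  (fps_inv_prefix a n)`_i = (fps_inv_prefix a i)`_i.
Proof.
elim: n => [|n IHn]; first by rewrite leqn0 => /eqP ->.
rewrite leq_eqVlt => /predU1P[-> //|]; rewrite ltnS => le_in.
by rewrite /= nth_rcons size_fps_inv_prefix ltnS le_in IHn.
Qed.

Lemma fps_mulV : {in fps_unit, left_inverse 1 fps_inv *%R}.
Proof.
move=> a; rewrite unfold_in => Ua; rewrite mulrC; apply: fpsP => n.
rewrite /GRing.mul /= /fps_inv /fps_unit Ua /= big_ord_recl subn0 /=.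
case: n => [|n] /=; first by rewrite big_ord0 addr0 divrr.
rewrite nth_rcons size_fps_inv_prefix ltnn eqxx mulrA mulrN divrr // mulN1r.
apply/eqP; rewrite addrC subr_eq0; apply/eqP.
apply: eq_bigr => i _; rewrite /bump leq0n add1n subSS.
by rewrite [in RHS]nth_fps_inv_prefix ?leq_subr.
Qed.

Lemma fps_unitPl a b : b * a = 1 -> fps_unit a.
Proof.
move/(congr1 (fun c : fps R => coefs c 0)) => /=.
rewrite big_ord1 subnn => ba1; apply/unitrPr.
by exists (coefs b 0); rewrite mulrC.
Qed.

Lemma fps_inv_out : {in [predC fps_unit], fps_inv =1 id}.
Proof. by move=> a; rewrite inE => /negPf Ua; rewrite /fps_inv -[fps_unit a]/(a \in fps_unit) Ua. Qed.

HB.instance Definition _ := GRing.ComNzRing_hasMulInverse.Build (fps R)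
  fps_mulV fps_unitPl fps_inv_out.

End FpsRing.

(* f_n = \prod_(j >= 1) (1 - q^(n j)). For n >= 1 the factors with j > N do not
   affect the coefficient of q^N (see coef_f_stable), so that coefficient is
   read off the finite product over 1 <= j <= N. *)
Definition f_ (n : nat) : fps int :=
  FPS (fun N => (\prod_(1 <= j < N.+1) (1 - 'X^(n * j)) : {poly int})`_N).

Lemma coef_f_stable n N M : (0 < n)%N -> (N <= M)%N ->
  coefs (f_ n) N = (\prod_(1 <= j < M.+1) (1 - 'X^(n * j)) : {poly int})`_N.
Proof.
move=> n_gt0 /subnKC <-; elim: (M - N)%N => [|d IHd]; first by rewrite addn0.
rewrite IHd addnS [in RHS]big_nat_recr //= mulrBr mulr1 coefB coefMXn.
rewrite (leq_trans _ (leq_pmull _ n_gt0)) ?subr0 //.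
by rewrite ltnS leq_addr.
Qed.

Lemma unit_f n : f_ n \is a GRing.unit.
Proof.
change (coefs (f_ n) 0 \is a GRing.unit).
by rewrite /= big_geq // coef1 unitr1.
Qed.

Definition delta (m k n : nat) : int :=
  coefs (f_ 1 ^+ k / f_ m ^+ k) n.

Definition delta' (m k n : nat) : int :=
  coefs (f_ m ^+ k / f_ 1 ^+ k) n.

Definition delta2 (l m k n : nat) : int :=
  coefs ((f_ 1 ^+ k * f_ l ^+ k) / (f_ m ^+ k * f_ (l * m) ^+ k)) n.

Definition delta2' (l m k n : nat) : int :=
  coefs ((f_ m ^+ k * f_ (l * m) ^+ k) / (f_ 1 ^+ k * f_ l ^+ k)) n.

(* Main.v *)
(** Write U_p for the extraction of a residue class of exponents modulo p. Since f_p^k is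
    a series in q^p, each claim says that U_p sends F = f_1^k (or f_1^k f_l^k) to a multiple
    of F(q^p). When F is a product of two unary theta series, F is a sum over a binary
    quadratic form; if that form is anisotropic modulo p, the exponents in the relevant class
    come only from the sublattice of multiples of p, on which the form is multiplied by p^2
    and the coefficients by a constant. Euler's and Jacobi's expansions of f_1 and f_1^3,
    with Gauss's phi(-q) = f_1^2/f_2 and psi(q) = f_2^2/f_1, cover most cases.
    For p = 5 and F = f_1^k one has f_1 = g(q^5) (1 - t - t^2) with t = q r(q^5), which follows
    from the absence of exponents 5n+2 in f_1^3; likewise f_1 f_2 = g(q^3) (1 - t - 2 t^2)
    with t = q r(q^3), and the constants are coefficients of powers of these polynomials.
    Finally f_1^2 f_3^2 is a difference of two binary theta series, by
    f_3^2 = psi(q^2) phi(q^9) - q^2 phi(q) psi(q^18) together with the weight 3/2 expansions of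
    f_1^2 psi(q^2) and f_1^2 phi(q). *)
From HB Require Import structures.
Require Import Defs.
From mathcomp Require Import all_boot all_order all_algebra.
From mathcomp Require Import boolp classical_sets functions cardinality fsbigop.
From mathcomp Require Import zify ring.

Set Implicit Arguments.
Unset Strict Implicit.
Unset Printing Implicit Defensive.

Import Order.TTheory GRing.Theory Num.Theory.
Local Open Scope ring_scope.

(** * Formal power series *)

Section FpsTheory.
Implicit Types a b : fps int.

Definition q : fps int := FPS (fun n => (n == 1%N)%:R).

Lemma coefsM a b n :
  coefs (a * b) n = \sum_(i < n.+1) coefs a i * coefs b (n - i).
Proof. by []. Qed.

Lemma coefsD a b n : coefs (a + b) n = coefs a n + coefs b n.
Proof. by []. Qed.

Lemma coefsN a n : coefs (- a) n = - coefs a n.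
Proof. by []. Qed.

Lemma coefs_sum I r (P : pred I) (F : I -> fps int) n :
  coefs (\sum_(i <- r | P i) F i) n = \sum_(i <- r | P i) coefs (F i) n.
Proof. exact: (big_morph (fun a => coefs a n) (fun a b => coefsD a b n)). Qed.

Lemma coefsMz a (z : int) n : coefs (z%:~R * a) n = z * coefs a n.
Proof.
have H (m : nat) : coefs (m%:R * a) n = m%:Z * coefs a n.
  elim: m => [|m IHm]; first by rewrite !mul0r.
  by rewrite mulrS mulrDl mul1r coefsD IHm intS mulrDl mul1r.
case: z => m; first by rewrite -pmulrn H.
by rewrite NegzE mulrNz mulNr coefsN -pmulrn H mulNr.
Qed.

Lemma coefs_qXM k a n :
  coefs (q ^+ k * a) n = if (n < k)%N then 0 else coefs a (n - k).
Proof.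
elim: k n => [|k IHk] n; first by rewrite mul1r subn0.
rewrite exprS -mulrA coefsM; case: n => [|n].
  by rewrite big_ord1 mul0r.
rewrite big_ord_recl mul0r add0r big_ord_recl mul1r big1 ?addr0 => [|i _].
  by rewrite IHk ltnS !subSS subn0.
by rewrite mul0r.
Qed.

Lemma coefs_qX k n : coefs (q ^+ k) n = (n == k)%:R.
Proof.
rewrite -[q ^+ k]mulr1 coefs_qXM; case: ltngtP => // [lt_kn|->].
  by rewrite -[RHS]/(0%:R) /=; congr (_%:R); case: (n - k)%N (subn_gt0 k n) => //;
      rewrite lt_kn.
by rewrite subnn.
Qed.

Lemma unit_coefs0 a : coefs a 0 = 1 -> a \is a GRing.unit.
Proof. by move=> a0; change (coefs a 0 \is a GRing.unit); rewrite a0 unitr1. Qed.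

Definition fps_poly (u : {poly int}) : fps int := FPS (fun n => u`_n).

Lemma fps_polyM u v : fps_poly (u * v) = fps_poly u * fps_poly v.
Proof. by apply: fpsP => n; rewrite coefsM /= coefM. Qed.

Lemma fps_polyXn k : fps_poly 'X^k = q ^+ k.
Proof. by apply: fpsP => n; rewrite coefs_qX /= coefXn. Qed.

Lemma fps_poly_prod (F : nat -> {poly int}) m :
  fps_poly (\prod_(j < m) F j) = \prod_(j < m) fps_poly (F j).
Proof.
apply: (big_morph fps_poly fps_polyM); apply: fpsP => n.
by rewrite /= coef1.
Qed.

(** Congruence modulo q^N. Infinite products are compared here, where they become finite, and
    [eqm_all] returns to equality. *)
Definition eqm N a b := forall i, (i < N)%N -> coefs a i = coefs b i.

Lemma eqm_refl N a : eqm N a a. Proof. by []. Qed.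

Lemma eqm_sym N a b : eqm N a b -> eqm N b a.
Proof. by move=> ab i /ab. Qed.

Lemma eqm_trans N b a c : eqm N a b -> eqm N b c -> eqm N a c.
Proof. by move=> ab bc i iN; rewrite ab ?bc. Qed.

Lemma eqmW M N a b : (N <= M)%N -> eqm M a b -> eqm N a b.
Proof. by move=> NM ab i /leq_trans/(_ NM)/ab. Qed.

Lemma eqmM N a a' b b' : eqm N a a' -> eqm N b b' -> eqm N (a * b) (a' * b').
Proof.
move=> aa bb n nN; rewrite !coefsM; apply: eq_bigr => i _.
by rewrite aa ?bb // (leq_ltn_trans _ nN) ?leq_subr // -ltnS ltn_ord.
Qed.

Lemma eqmX N a b k : eqm N a b -> eqm N (a ^+ k) (b ^+ k).
Proof. by move=> ab; elim: k => // k IHk; rewrite !exprS; apply: eqmM. Qed.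

Lemma eqm_sum N I (r : seq I) (P : pred I) (F G : I -> fps int) :
  (forall i, P i -> eqm N (F i) (G i)) ->
  eqm N (\sum_(i <- r | P i) F i) (\sum_(i <- r | P i) G i).
Proof. by move=> FG n nN; rewrite !coefs_sum; apply: eq_bigr => i /FG; apply. Qed.

Lemma eqm_qX N k a b : eqm (N - k) a b -> eqm N (q ^+ k * a) (q ^+ k * b).
Proof.
move=> ab n nN; rewrite !coefs_qXM; case: ltnP => // kn.
by apply: ab; rewrite ltn_sub2r // (leq_ltn_trans kn).
Qed.

Lemma qX_inj k a b : q ^+ k * a = q ^+ k * b -> a = b.
Proof.
move=> ab; apply: fpsP => n.
have : coefs (q ^+ k * a) (k + n) = coefs (q ^+ k * b) (k + n) by rewrite ab.
by rewrite !coefs_qXM ltnNge leq_addr addKn.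
Qed.

Lemma eqm_all a b : (forall N, eqm N a b) -> a = b.
Proof. by move=> ab; apply: fpsP => n; apply: (ab n.+1). Qed.

Lemma eqm_divl N u a b : u \is a GRing.unit -> eqm N (u * a) (u * b) -> eqm N a b.
Proof.
move=> Uu ab; rewrite -[a](mulKr Uu) -[b](mulKr Uu).
by apply: eqmM => //; apply: eqm_refl.
Qed.

Lemma sum_dvdn (V : nmodType) p n (G : nat -> V) : (0 < p)%N ->
  \sum_(i < n.+1 | (p %| i)%N) G i = \sum_(j < (n %/ p).+1) G (p * j)%N.
Proof.
move=> p_gt0; elim: n => [|n IHn].
  by rewrite div0n big_mkcond !big_ord1 /= dvdn0 muln0.
rewrite big_mkcond big_ord_recr -big_mkcond /= IHn divnS //.
case: ifP => pn; last by rewrite addr0.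
rewrite add1n [RHS]big_ord_recr /=; congr (_ + G _).
by rewrite -{1}(divnK pn) divnS // pn add1n mulnC.
Qed.

(** The substitution of q^p for q. *)
Definition dil p a : fps int :=
  FPS (fun n => if (p %| n)%N then coefs a (n %/ p) else 0).

Lemma dil_is_zmod_morphism p : zmod_morphism (dil p).
Proof.
by move=> a b; apply: fpsP => n /=; case: ifP; rewrite ?subr0.
Qed.

Lemma coefs_Mdil p a b n : (0 < p)%N ->
  coefs (a * dil p b) n =
  \sum_(j < (n %/ p).+1) coefs a (n - p * j) * coefs b j.
Proof.
move=> p_gt0; rewrite mulrC coefsM.
rewrite (eq_bigr (fun i : 'I_n.+1 => if (p %| i)%N then
   coefs a (n - i) * coefs b (i %/ p) else 0)) => [|i _].
  rewrite -big_mkcond (sum_dvdn _ (fun i => coefs a (n - i) * coefs b (i %/ p))) //.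
  by apply: eq_bigr => j _; rewrite mulKn.
by rewrite /=; case: ifP => _; rewrite ?mul0r // mulrC.
Qed.

Lemma dil_is_monoid_morphism p : monoid_morphism (dil p).
Proof.
split=> [|a b]; apply: fpsP => n.
  rewrite /=; case: ifP => [/dvdnP[k ->]|]; last by case: n => //; rewrite dvdn0.
  case: p => [|p]; first by rewrite muln0 divn0.
  by rewrite mulnK // muln_eq0 orbF.
(* [dil 0] keeps only the constant term, which is multiplicative too. *)
case: (posnP p) => [->|p_gt0].
  rewrite /= dvd0n; case: eqP => [->|/eqP n0].
    by rewrite div0n !big_ord1 subn0 dvd0n eqxx.
  rewrite big1 // => i _; rewrite !dvd0n.
  by case: eqP => [->|_]; rewrite ?mul0r // subn0 (negPf n0) mulr0.
rewrite coefs_Mdil //= ; case: ifP => [/dvdnP[k ->]|npn].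
  rewrite mulnK // [LHS](reindex_inj rev_ord_inj) /=.
  apply: eq_bigr => j _; rewrite [(k * p)%N]mulnC -mulnBr dvdn_mulr // mulKn //.
  by rewrite subSS subKn // -ltnS.
rewrite big1 // => j _; case: ifP; last by rewrite mul0r.
move=> /dvdnP[k E]; have lt_j := ltn_ord j.
have : (p * j <= n)%N by rewrite (leq_trans _ (leq_trunc_div n p)) // mulnC leq_mul.
move/subnK; rewrite E => E'; have: (p %| n)%N.
  by rewrite -E' (dvdn_add (dvdn_mull k (dvdnn p)) (dvdn_mulr j (dvdnn p))).
by rewrite npn.
Qed.

HB.instance Definition _ p := GRing.isZmodMorphism.Build _ _ (dil p) (dil_is_zmod_morphism p).
HB.instance Definition _ p := GRing.isMonoidMorphism.Build _ _ (dil p)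
    (dil_is_monoid_morphism p).

Lemma dil_q p : (0 < p)%N -> dil p q = q ^+ p.
Proof.
move=> p_gt0; apply: fpsP => n; rewrite coefs_qX /=.
case: ifP => [/dvdnP[k ->]|]; first by rewrite mulnK // -{2}[p]mul1n eqn_pmul2r.
by case: eqP => // ->; rewrite dvdnn.
Qed.

Lemma dil_eqm p N a b : (0 < p)%N -> eqm N a b -> eqm N (dil p a) (dil p b).
Proof.
move=> p_gt0 ab n nN /=; case: ifP => // _; apply: ab.
exact: leq_ltn_trans (leq_div n p) nN.
Qed.

(** The operator U_p of the overview, on the residue class [r]. *)
Definition sect p r a : fps int := FPS (fun n => coefs a (p * n + r)).

Lemma sectD p r a b : sect p r (a + b) = sect p r a + sect p r b.
Proof. exact: fpsP. Qed.

(** A series in q^p does not mix residue classes, so it leaves the section as a factor, with q^p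
    renamed q. *)
Lemma sect_Mdil p r a b : (r < p)%N -> sect p r (a * dil p b) = sect p r a * b.
Proof.
move=> rp; have p_gt0 : (0 < p)%N := leq_ltn_trans (leq0n r) rp.
apply: fpsP => n; rewrite [sect p r a * b]mulrC coefsM.
rewrite -[LHS]/(coefs (a * dil p b) (p * n + r)) coefs_Mdil // mulnC divnMDl // divn_small //
    addn0.
apply: eq_bigr => j _; rewrite mulrC; congr (_ * coefs a _).
rewrite mulnBr mulnC addnBAC // leq_mul2l -ltnS ltn_ord orbT //.
Qed.

Lemma sect_qXdil p r k b : (r < p)%N ->
  sect p r (q ^+ k * dil p b) = if (k %% p == r)%N then q ^+ (k %/ p) * b else 0.
Proof.
move=> rp; have p_gt0 : (0 < p)%N := leq_ltn_trans (leq0n r) rp.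
rewrite sect_Mdil // ; case: eqP => [kr|nkr].
  congr (_ * _); apply: fpsP => n; rewrite /= !coefs_qX; congr (_%:R).
  rewrite {1}(divn_eq k p) kr eqn_add2r mulnC eqn_pmul2r //.
rewrite [sect _ _ _](_ : _ = 0) ?mul0r //; apply: fpsP => n; rewrite /= coefs_qX.
case: eqP => // E; case: nkr; rewrite -E mulnC modnMDl modn_small //.
Qed.

Lemma sect_decomp p a : (0 < p)%N -> a = \sum_(r < p) q ^+ r * dil p (sect p r a).
Proof.
move=> p_gt0; apply: fpsP => n; rewrite coefs_sum.
rewrite (bigD1 (Ordinal (ltn_pmod n p_gt0))) // big1 => [|r nr].
  rewrite Monoid.mulm1 coefs_qXM /= ltnNge leq_mod /=.
  have E : (n - n %% p = n %/ p * p)%N by rewrite {1}(divn_eq n p) addnK.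
  by rewrite E dvdn_mull // mulnK // mulnC -divn_eq.
rewrite coefs_qXM; case: ltnP => //= rn; case: ifP => // pnr.
case/eqP: nr; apply: val_inj => /=.
by rewrite -(subnK rn); case/dvdnP: pnr => k ->; rewrite modnMDl modn_small.
Qed.

(** The substitution of -q for q. *)
Definition alt a : fps int := FPS (fun n => (-1) ^+ n * coefs a n).

Lemma alt_is_zmod_morphism : zmod_morphism alt.
Proof. by move=> a b; apply: fpsP => n /=; rewrite mulrBr. Qed.

Lemma alt_is_monoid_morphism : monoid_morphism alt.
Proof.
split=> [|a b]; apply: fpsP => n; first by case: n => //= n; rewrite mulr0.
rewrite /= mulr_sumr; apply: eq_bigr => i _.
by rewrite -[in (-1) ^+ n](@subnKC i n) -1?ltnS // exprD mulrACA.
Qed.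

HB.instance Definition _ := GRing.isZmodMorphism.Build _ _ alt alt_is_zmod_morphism.
HB.instance Definition _ := GRing.isMonoidMorphism.Build _ _ alt alt_is_monoid_morphism.

Lemma alt_dil2 a : alt (dil 2 a) = dil 2 a.
Proof.
apply: fpsP => n /=; rewrite dvdn2; case: ifP => [no|]; last by rewrite mulr0.
by rewrite -signr_odd (negPf no) mul1r.
Qed.

End FpsTheory.

(** * Truncated Euler products *)

Section EulerProducts.

(** The omitted factors are 1 modulo q^(n (m+1)), and n (m+1) >= m+1 >= N. *)
Lemma f_eqm n N m : (0 < n)%N -> (N <= m.+1)%N ->
  eqm N (f_ n) (\prod_(j < m) (1 - q ^+ (n * j.+1))).
Proof.
move=> n_gt0 Nm i iN; rewrite (@coef_f_stable n i m) //; last first.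
  by rewrite -ltnS (leq_trans iN).
rewrite big_add1 [m.+1.-1]/= big_mkord.
rewrite -[LHS]/(coefs (fps_poly (\prod_(j < m) (1 - 'X^(n * j.+1)))) i).
rewrite (fps_poly_prod (fun j => 1 - 'X^(n * j.+1))); congr (coefs _ i).
apply: eq_bigr => j _; rewrite -fps_polyXn.
by apply: fpsP => k; rewrite /= coefB coef1.
Qed.

Lemma dil_f p n : (0 < p)%N -> (0 < n)%N -> dil p (f_ n) = f_ (p * n).
Proof.
move=> p_gt0 n_gt0; apply: eqm_all => N.
have f1 := f_eqm n_gt0 (leqnSn N).
have pn_gt0 : (0 < p * n)%N by rewrite muln_gt0 p_gt0.
apply: eqm_trans (eqm_sym (f_eqm pn_gt0 (leqnSn N))).
apply: eqm_trans (dil_eqm p_gt0 f1) _; rewrite rmorph_prod /=.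
rewrite (eq_bigr (fun j : 'I_N => 1 - q ^+ (p * n * j.+1))) => [|j _].
  exact: eqm_refl.
by rewrite rmorphB rmorph1 rmorphXn /= dil_q // -exprM mulnA.
Qed.

End EulerProducts.

(** * Theta series *)

Section Theta.
Local Open Scope classical_set_scope.

(* \sum_i c_i q^((E_i - s) / 24); the factor 24 clears the denominators of all the
   exponents below. *)
Definition theta (I : choiceType) (c E : I -> int) (s : int) : fps int :=
  FPS (fun N => \sum_(i \in [set i | E i = 24 * N%:Z + s]) c i).

(** The first clause makes every index contribute to exactly one coefficient. The second keeps the
    sums honest: a sum with infinite support is 0 by convention. *)
Definition good (I : choiceType) (E : I -> int) (s : int) :=
  (forall i, exists N : nat, E i = 24 * N%:Z + s) /\
  (forall v, finite_set [set i | E i = v]).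

Lemma eq_theta (I : choiceType) (c c' E E' : I -> int) s :
  c =1 c' -> E =1 E' -> theta c E s = theta c' E' s.
Proof. by move=> /funext -> /funext ->. Qed.

Lemma theta_reindex (I J : choiceType) (h : J -> I) (c E : I -> int)
    (c' E' : J -> int) s :
  injective h -> (forall i (N : nat), E i = 24 * N%:Z + s -> exists j, i = h j) ->
  (forall j, c (h j) = c' j) -> (forall j, E (h j) = E' j) ->
  theta c E s = theta c' E' s.
Proof.
move=> injh surj cc EE; apply: fpsP => N /=.
rewrite (reindex_fsbig h [set j | E' j = 24 * N%:Z + s]).
  by apply: eq_fsbigr => j _; rewrite cc.
split=> [j /= <-|i j _ _ /injh//|i /= Ei]; first by rewrite EE.
by have [j ij] := surj _ _ Ei; exists j; rewrite /= -?EE -ij.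
Qed.

Lemma theta_bij (I J : choiceType) (h : J -> I) (c E : I -> int) s :
  bijective h -> theta c E s = theta (c \o h) (E \o h) s.
Proof.
move=> bh; apply: (theta_reindex (h := h)) => //; first exact: bij_inj.
by case: bh => g _ gK i _ _; exists (g i); rewrite gK.
Qed.


Lemma theta_split3 (I J1 J2 J3 : choiceType) (h1 : J1 -> I) (h2 : J2 -> I)
    (h3 : J3 -> I) (c E : I -> int) s :
  good E s -> injective h1 -> injective h2 -> injective h3 ->
  (forall x y, h1 x <> h2 y) -> (forall x y, h1 x <> h3 y) ->
  (forall x y, h2 x <> h3 y) ->
  (forall i, (exists j, i = h1 j) \/ (exists j, i = h2 j) \/ (exists j, i = h3 j)) ->
  theta c E s = theta (c \o h1) (E \o h1) s + theta (c \o h2) (E \o h2) s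
              + theta (c \o h3) (E \o h3) s.
Proof.
move=> [_ finE] i1 i2 i3 d12 d13 d23 cov; apply: fpsP => N; rewrite !coefsD /=.
set v := 24 * N%:Z + s.
have im (J : choiceType) (h : J -> I) : injective h ->
    \sum_(j \in [set j | (E \o h) j = v]) (c \o h) j =
    \sum_(i \in h @` [set j | (E \o h) j = v]) c i.
  by move=> injh; rewrite fsbig_image // => x y _ _ /injh.
have fin (J : choiceType) (h : J -> I) : finite_set (h @` [set j | (E \o h) j = v]).
  by apply: sub_finite_set (finE v) => _ [j /= Ej <-].
rewrite (im _ _ i1) (im _ _ i2) (im _ _ i3).
have d12' : h1 @` [set j | (E \o h1) j = v] `&` h2 @` [set j | (E \o h2) j = v] `<=` set0.
  by move=> _ [[x _ <-] [y _]] /esym/d12.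
rewrite -(@fsbigU0 _ _ _ _ _ _ c (fin _ h1) (fin _ h2) d12') -fsbigU0 //; first last.
- by move=> _ [[[x _ <-]|[x _ <-]] [y _]] /esym; [move/d13|move/d23].
- by rewrite finite_setU; split.
apply: eq_fsbigl; apply/seteqP; split=> i /=.
  by move=> Ei; case: (cov i) => [[j ij]|[[j ij]|[j ij]]];
    [left; left|left; right|right]; exists j; rewrite /= -?ij.
by move=> [[[j Ej <-]|[j Ej <-]]|[j Ej <-]].
Qed.

Lemma theta_split2 (I J1 J2 : choiceType) (h1 : J1 -> I) (h2 : J2 -> I)
    (c E : I -> int) s :
  good E s -> injective h1 -> injective h2 -> (forall x y, h1 x <> h2 y) ->
  (forall i, (exists j, i = h1 j) \/ (exists j, i = h2 j)) ->
  theta c E s = theta (c \o h1) (E \o h1) s + theta (c \o h2) (E \o h2) s.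
Proof.
move=> gE i1 i2 d12 cov.
(* The third family is indexed by the empty type. *)
rewrite (theta_split3 (h3 := fun x : void => match x with end) c gE i1 i2) //.
- rewrite -[RHS]addr0; congr (_ + _); apply: fpsP => N /=.
  by rewrite fsbig1 // => -[].
- by move=> i; case: (cov i); [left|right; left].
Qed.

Lemma thetaD (I : choiceType) (c d E : I -> int) s : good E s ->
  theta (fun i => c i + d i) E s = theta c E s + theta d E s.
Proof. by move=> [_ finE]; apply: fpsP => N; rewrite coefsD /= fsbig_split. Qed.

Lemma thetaZ (I : choiceType) (c E : I -> int) s k :
  theta (fun i => k * c i) E s = k%:~R * theta c E s.
Proof. by apply: fpsP => N; rewrite coefsMz /= mulr_fsumr. Qed.

(** Reindexing by [h] turns the series into its negative, and the integers have no 2-torsion. *)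
Lemma theta_odd0 (I : choiceType) (h : I -> I) (c E : I -> int) s :
  involutive h -> (forall i, c (h i) = - c i) -> (forall i, E (h i) = E i) ->
  theta c E s = 0.
Proof.
move=> hK ch Eh; have bh : bijective h by exists h.
have := theta_bij c E s bh.
rewrite [RHS](eq_theta s (c' := fun i => -1 * c i) (E' := E)) => [|i|i] /=.
- rewrite thetaZ => H; apply: fpsP => N.
  have : coefs (theta c E s) N = coefs ((-1)%:~R * theta c E s) N by rewrite -H.
  rewrite coefsMz /=; lia.
- by rewrite ch mulN1r.
- exact: Eh.
Qed.

Lemma fsum_ord_fibers (I : choiceType) (A : set I) (w : I -> nat) n (G : I -> int) :
  finite_set A -> (forall i, A i -> (w i < n)%N) ->
  \sum_(i \in A) G i = \sum_(k < n) \sum_(i \in A `&` [set i | w i = k]) G i.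
Proof.
move=> finA wn; rewrite fsbig_finite //.
rewrite (eq_big_seq (fun i => \sum_(k < n) if w i == k then G i else 0)); last first.
  move=> i; rewrite in_fset_set // inE => Ai.
  rewrite (bigD1 (Ordinal (wn i Ai))) //= eqxx big1 ?addr0 // => k kw.
  by case: eqP => // E; case/eqP: kw; apply: val_inj.
rewrite exchange_big /=; apply: eq_bigr => k _.
rewrite -big_mkcond -big_filter fsbig_seq ?filter_uniq ?fset_uniq //.
apply: eq_fsbigl; apply/seteqP; split=> i /=.
  by rewrite mem_filter in_fset_set // => /andP[/eqP wi /set_mem].
by case=> /mem_set Ai wi; rewrite mem_filter in_fset_set // wi eqxx.
Qed.

Lemma good_pair (I J : choiceType) (E : I -> int) (F : J -> int) s t :
  good E s -> good F t -> good (fun x : I * J => E x.1 + F x.2) (s + t).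
Proof.
move=> [admE finE] [admF finF]; split=> [[i j] /=|v].
  have [M ->] := admE i; have [N ->] := admF j.
  by exists (M + N)%N; lia.
pose n := absz (v - s - t)%R.
apply: (@sub_finite_set _ _ (\bigcup_(k in `I_n.+1)
   ([set i | E i = 24 * k%:Z + s] `*` [set j | F j = v - (24 * k%:Z + s)]))).
  move=> [i j] /= Ev; have [M EM] := admE i; have [N EN] := admF j.
  exists M => /=; first by rewrite /n; lia.
  by split=> //=; lia.
apply: bigcup_finite; first exact: finite_II.
by move=> k _; apply: finite_setX.
Qed.

(** The pairs contributing to q^N are sorted by the exponent of their first component, which is the
    summation index of the Cauchy product. *)
Lemma theta_mul (I J : choiceType) (c E : I -> int) (d F : J -> int) s t :
  good E s -> good F t ->
  theta c E s * theta d F t =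
  theta (fun x : I * J => c x.1 * d x.2) (fun x => E x.1 + F x.2) (s + t).
Proof.
move=> gE gF; have [_ finEF] := good_pair gE gF.
case: gE gF => [admE finE] [admF finF]; apply: fpsP => N; rewrite coefsM /=.
rewrite (@fsum_ord_fibers _ _ (fun x => absz ((E x.1 - s)%R %/ 24)%Z) N.+1) //; last first.
  move=> [i j] /=; have [M EM] := admE i; have [L EL] := admF j.
  by rewrite EM EL; lia.
apply: eq_bigr => k _; rewrite mulr_fsuml.
under eq_fsbigr do rewrite mulr_fsumr.
rewrite pair_fsbig //; apply: eq_fsbigl; apply/seteqP; split=> -[i j] /=.
  by move=> [Ei Fj]; have := ltn_ord k; lia.
have [M EM] := admE i; have [L EL] := admF j.
by have := ltn_ord k; rewrite EM EL; move=> ? [/= ? ?]; split; lia.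
Qed.

Lemma good_scale (I : choiceType) (E : I -> int) s (p : nat) : (0 < p)%N ->
  good E s -> good (fun i => p%:Z * E i) (p%:Z * s).
Proof.
move=> p_gt0 [admE finE]; split=> [i|v].
  by have [N ->] := admE i; exists (p * N)%N; lia.
apply: sub_finite_set (finE (v %/ p)%Z) => i /= <-.
by rewrite mulrC mulzK; lia.
Qed.

Lemma dil_theta (I : choiceType) (c E : I -> int) s p : (0 < p)%N ->
  good E s -> dil p (theta c E s) = theta c (fun i => p%:Z * E i) (p%:Z * s).
Proof.
move=> p_gt0 [admE _]; apply: fpsP => N /=; case: ifP => [/dvdnP[k ->]|npN].
  rewrite mulnK //; apply: eq_fsbigl; apply/seteqP; split=> i /= H.
    by rewrite H; lia.
  have {}H : p%:Z * E i = p%:Z * (24 * k%:Z + s) by lia.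
  by apply: (mulfI _ H); lia.
rewrite fsbig1 // => i /= H; have [M EM] := admE i.
have E' : N = (p * M)%N by rewrite EM in H; lia.
by move: npN; rewrite E' dvdn_mulr.
Qed.

Lemma theta_shift (I : choiceType) (c E : I -> int) s k :
  good E s -> q ^+ k * theta c E s = theta c E (s - 24 * k%:Z).
Proof.
move=> [admE _]; apply: fpsP => N; rewrite coefs_qXM /=; case: ltnP => kN.
  by rewrite fsbig1 // => i /=; have [M ->] := admE i; lia.
by apply: eq_fsbigl; apply/seteqP; split=> i /=; lia.
Qed.

Lemma sect_theta0 (I : choiceType) (c E : I -> int) s p r :
  (forall i (N : int), E i <> 24 * (p%:Z * N + r%:Z) + s) ->
  sect p r (theta c E s) = 0.
Proof.
move=> nE; apply: fpsP => N /=; rewrite fsbig1 // => i /= Ei.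
by case: (nE i N); lia.
Qed.

(* The relation between u, r and s says that p (24 N + p s) is the value of E at the
   exponent p (N + u) + r. *)
Lemma sect_theta (I : choiceType) (h : I -> I) (c E : I -> int) s p r u k :
  (0 < p)%N -> good E s -> 24 * (p%:Z * u%:Z + r%:Z) = (p%:Z * p%:Z - 1) * s ->
  injective h ->
  (forall i N, E i = p%:Z * (24 * N + p%:Z * s) -> exists j, i = h j) ->
  (forall j, E (h j) = p%:Z * (p%:Z * E j)) -> (forall j, c (h j) = k * c j) ->
  sect p r (theta c E s) = k%:~R * (q ^+ u * dil p (theta c E s)).
Proof.
move=> p_gt0 gE su injh surj Eh ch; rewrite dil_theta // theta_shift; last exact: good_scale.
apply: fpsP => N; rewrite coefsMz /= mulr_fsumr.
have Ev : 24 * (p * N + r)%N%:Z + s = p%:Z * (24 * (N%:Z - u%:Z) + p%:Z * s) by lia.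
rewrite Ev (reindex_fsbig h [set j | p%:Z * E j = 24 * N%:Z + (p%:Z * s - 24 * u%:Z)]).
  by apply: eq_fsbigr => j _; rewrite ch.
have p0 : p%:Z != 0 by lia.
split=> [j /= Ej|i j _ _ /injh//|i /= Ei].
  by rewrite Eh Ej; congr (_ * _); lia.
have [j ij] := surj _ _ Ei; exists j => //=; apply: (mulfI p0).
by rewrite -Eh -ij Ei; congr (_ * _); lia.
Qed.

Lemma alt_theta (I : choiceType) (c E : I -> int) (e : I -> nat) s :
  (forall i, E i = 24 * (e i)%:Z + s) ->
  alt (theta c E s) = theta (fun i => (-1) ^+ e i * c i) E s.
Proof.
move=> Ee; apply: fpsP => N /=; rewrite mulr_fsumr; apply: eq_fsbigr => i.
rewrite inE /= Ee => ei; congr (_ ^+ _ * _); lia.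
Qed.

Lemma theta_eqm (I : choiceType) (c E : I -> int) (e : I -> nat) s (r : seq I) N :
  uniq r -> (forall i, E i = 24 * (e i)%:Z + s) ->
  (forall i, (e i < N)%N -> i \in r) ->
  eqm N (theta c E s) (\sum_(i <- r) (c i)%:~R * q ^+ e i).
Proof.
move=> ur Ee cov n nN; rewrite coefs_sum.
rewrite (eq_bigr (fun i => if e i == n then c i else 0)) => [|i _]; last first.
  by rewrite coefsMz coefs_qX eq_sym; case: eqP; rewrite ?mulr1 ?mulr0.
rewrite -big_mkcond -big_filter fsbig_seq ?filter_uniq //.
apply: eq_fsbigl; apply/seteqP; split=> i /=; rewrite mem_filter Ee.
  move=> H; have en : e i = n by lia.
  by rewrite en eqxx cov ?en.
by case/andP => /eqP <-.
Qed.

Lemma good_int (E : int -> int) s :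
  (forall i, exists2 z, 0 <= z & E i = 24 * z + s) ->
  (forall i, `|i| <= E i + 1) -> good E s.
Proof.
move=> adm bnd; split=> [i|v].
  by have [z z0 ->] := adm i; exists (absz z); lia.
pose n := absz (v + 1)%R.
apply: (@sub_finite_set _ _ ((fun k : nat => k%:Z - n%:Z) @` `I_(n.*2.+1))).
  move=> i /= Ei; have := bnd i; rewrite Ei => Hi.
  by exists (absz (i + n%:Z)%R) => /=; rewrite /n in Hi *; lia.
exact/finite_image/finite_II.
Qed.

End Theta.

(** * The Jacobi triple product *)

Section GaussianBinomials.

(** Gaussian binomial coefficients through a q-Pascal rule, which avoids division by
    q-factorials. *)
Fixpoint gbin (R : comNzRingType) (Q : R) N k : R :=
  match N, k with
  | _, 0%N => 1
  | 0%N, _.+1 => 0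
  | N'.+1, k'.+1 => gbin Q N' k'.+1 + Q ^+ (N' - k') * gbin Q N' k'
  end.

Lemma gbin0 (R : comNzRingType) (Q : R) N : gbin Q N 0 = 1.
Proof. by case: N. Qed.

Lemma gbinS (R : comNzRingType) (Q : R) N k :
  gbin Q N.+1 k.+1 = gbin Q N k.+1 + Q ^+ (N - k) * gbin Q N k.
Proof. by []. Qed.

Lemma gbin_small (R : comNzRingType) (Q : R) N k : (N < k)%N -> gbin Q N k = 0.
Proof.
elim: N k => [|N IHN] [|k] //=; rewrite ltnS => Nk.
by rewrite !IHN ?mulr0 ?addr0 // ltnW.
Qed.

Lemma gbin_rmorph (R S : comNzRingType) (g : {rmorphism R -> S}) (Q : R) N k :
  g (gbin Q N k) = gbin (g Q) N k.
Proof.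
elim: N k => [|N IHN] [|k] /=; rewrite ?rmorph0 ?rmorph1 //.
by rewrite rmorphD rmorphM rmorphXn /= !IHN.
Qed.

(** Homogeneous form of the finite q-binomial theorem. The variable [y] later absorbs what would be
    negative powers of q. Induction on [N] uses the q-Pascal rule. *)
Lemma gauss_binomial (R : comNzRingType) (Q y z : R) N :
  \prod_(j < N) (y + z * Q ^+ j) =
  \sum_(k < N.+1) Q ^+ 'C(k, 2) * gbin Q N k * z ^+ k * y ^+ (N - k).
Proof.
elim: N => [|N IHN]; first by rewrite big_ord0 big_ord1 /= !mulr1.
rewrite big_ord_recr /= {}IHN mulrDr !mulr_suml.
rewrite [X in X + _]big_ord_recl [in RHS]big_ord_recl /= !gbin0.
have -> : \sum_(i < N.+1) Q ^+ 'C(bump 0 i, 2) *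
      (gbin Q N i.+1 + Q ^+ (N - i) * gbin Q N i) * z ^+ bump 0 i *
      y ^+ (N.+1 - bump 0 i) =
    \sum_(i < N.+1) Q ^+ 'C(i.+1, 2) * gbin Q N i.+1 * z ^+ i.+1 * y ^+ (N - i)
  + \sum_(i < N.+1) Q ^+ 'C(i, 2) * gbin Q N i * z ^+ i * y ^+ (N - i) * (z * Q ^+ N).
  rewrite -big_split /=; apply: eq_bigr => i _.
  rewrite /bump /= add1n subSS.
  have iN : (i <= N)%N by rewrite -ltnS.
  have -> : Q ^+ N = Q ^+ i * Q ^+ (N - i) by rewrite -exprD subnKC.
  rewrite binS bin1 exprD exprS; ring.
rewrite addrA; congr (_ + _).
rewrite [in RHS]big_ord_recr /= gbin_small // mulr0 !mul0r addr0 !subn0.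
congr (_ + _); first by rewrite exprSr; ring.
apply: eq_bigr => i _; rewrite /bump /= add1n.
have -> : (N - i = (N - i.+1).+1)%N by have := ltn_ord i; lia.
by rewrite [y ^+ _.+1]exprSr mulrA.
Qed.

Definition qfact (R : comNzRingType) (Q : R) n := \prod_(j < n) (1 - Q ^+ j.+1).

Lemma gbin_qfact (R : comNzRingType) (Q : R) k m :
  gbin Q (k + m) k * qfact Q k * qfact Q m = qfact Q (k + m).
Proof.
have E n : qfact Q n.+1 = qfact Q n * (1 - Q ^+ n.+1) by rewrite /qfact big_ord_recr.
have E0 : qfact Q 0 = 1 by rewrite /qfact big_ord0.
move: {2}(k + m)%N (leqnn (k + m)) => N; elim: N k m => [|N IHN] [|k] [|m] leN.
- by rewrite /= /qfact big_ord0 !mulr1.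
- by [].
- by [].
- by [].
- by rewrite /= /qfact big_ord0 !mulr1.
- by rewrite add0n gbin0 {1}/qfact big_ord0 !mul1r.
- have := IHN k 0%N; rewrite addSn !addn0 E0 !mulr1 E mulrA => H.
  by rewrite -[in RHS]H /= ?subnn ?(gbin_small Q (ltnSn k)) ?add0r ?expr0 ?mul1r //; lia.
have H1 := IHN k.+1 m; have H2 := IHN k m.+1.
rewrite addnS addSn gbinS; have -> : ((k + m).+1 - k = m.+1)%N by lia.
rewrite addSn in H1; rewrite addnS in H2.
have {}H1 := H1 ltac:(lia); have {}H2 := H2 ltac:(lia).
rewrite !E in H1 H2 *.
(* The two terms of the Pascal rule combine by 1 - Q^(k+m+2) = (1 - Q^(m+1)) + Q^(m+1) (1 -
   Q^(k+1)). *)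
transitivity (gbin Q (k + m).+1 k.+1 * (qfact Q k * (1 - Q ^+ k.+1)) * qfact Q m * (1 - Q ^+
    m.+1)
  + Q ^+ m.+1 * (1 - Q ^+ k.+1) * (gbin Q (k + m).+1 k * qfact Q k * (qfact Q m * (1 - Q ^+
      m.+1)))).
  by ring.
rewrite H1 H2; have -> : Q ^+ (k + m).+2 = Q ^+ k.+1 * Q ^+ m.+1 by rewrite -exprD addSn addnS.
by ring.
Qed.

End GaussianBinomials.

Section JacobiTriple.

Lemma f_qfact b n N : (0 < b)%N -> (N <= n.+1)%N -> eqm N (f_ b) (qfact (q ^+ b) n).
Proof.
move=> b0 Nn; rewrite /qfact.
rewrite (eq_bigr (fun j : 'I_n => 1 - q ^+ (b * j.+1))) => [|j _]; last by rewrite exprM.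
exact: f_eqm.
Qed.

(** Modulo q^N all three q-factorials in [gbin_qfact] agree with [f_ b], and one copy of this unit
    cancels. *)
Lemma gbin_f b k m N : (0 < b)%N -> (N <= k.+1)%N -> (N <= m.+1)%N ->
  eqm N (gbin (q ^+ b) (k + m) k * f_ b) 1.
Proof.
move=> b0 Nk Nm; apply: (eqm_divl (unit_f b)); rewrite mulr1.
have Nkm : (N <= (k + m).+1)%N by lia.
apply: eqm_trans (eqm_sym (f_qfact b0 Nkm)); rewrite -gbin_qfact mulrCA -mulrA.
apply: eqmM; first exact: eqm_refl.
by apply: eqmM; apply: f_qfact.
Qed.

Lemma bin2_int k : 2 * ('C(k, 2))%:Z = k%:Z * (k%:Z - 1).
Proof.
elim: k => [|k IHk]; first by rewrite bin0n.
by rewrite binS bin1; lia.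
Qed.

Lemma even_triangle (i : int) : exists t, i * (i - 1) = 2 * t.
Proof.
have [j [->|->]] : exists j, i = 2 * j \/ i = 2 * j + 1.
- by exists (i %/ 2)%Z; lia.
- by exists (j * (2 * j - 1)); ring.
by exists (j * (2 * j + 1)); ring.
Qed.

Variables (a b : nat).
Hypotheses (a_gt0 : (0 < a)%N) (lt_ab : (a < b)%N).
Variable eps : int.
Hypothesis eps2 : eps * eps = 1.
Local Notation e := (eps%:~R : fps int).

(** The exponent b i (i-1) / 2 + a i; [jexpE] shows that the division is exact and the value
    nonnegative. *)
Definition jexp (i : int) : nat := absz ((b%:Z * (i * (i - 1)) + 2 * a%:Z * i) %/ 2)%Z.

(** The bound rests on 0 < a < b: for i = -m < 0 the exponent is b m (m-1) / 2 + (b-a) m. *)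
Lemma jexp_spec i :
  24 * (jexp i)%:Z = 12 * b%:Z * (i * (i - 1)) + 24 * a%:Z * i /\ (absz i <= jexp i)%N.
Proof.
have [t E] := even_triangle i.
have F : (b%:Z * (i * (i - 1)) + 2 * a%:Z * i = (b%:Z * t + a%:Z * i) * 2)%R.
  by rewrite E; ring.
rewrite /jexp F mulzK //.
have bE := congr1 (fun x => b%:Z * x) E; rewrite /= in bE.
suff : `|i| <= b%:Z * t + a%:Z * i by lia.
have [i0|i0] := lerP 0 i.
  have t0 : 0 <= t by nia.
  have : 0 <= b%:Z * t by nia.
  have : 0 <= (a%:Z - 1) * i by nia.
  by lia.
have : 0 <= b%:Z * (- i * (- i - 1)) by apply: mulr_ge0; nia.
have : 0 <= (b%:Z - 1 - a%:Z) * - i by apply: mulr_ge0; lia.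
by lia.
Qed.

Lemma jexpE i : 24 * (jexp i)%:Z = 12 * b%:Z * (i * (i - 1)) + 24 * a%:Z * i.
Proof. by case: (jexp_spec i). Qed.

Lemma jexp_ge i : (absz i <= jexp i)%N.
Proof. by case: (jexp_spec i). Qed.

(** The q-binomial theorem with 2n factors, Q = q^b, y = q^(b n) and z = eps q^a. A power of q is
    pulled out of each factor: the upper half leaves 1 + eps q^(a + b j), the lower half, read
    backwards, 1 + eps q^(b (j+1) - a). *)
Lemma jtp_finite n :
  \prod_(j < n) ((1 + e * q ^+ (a + b * j)) * (1 + e * q ^+ (b * j.+1 - a))) =
  \sum_(k < n.*2.+1) gbin (q ^+ b) n.*2 k *
     ((eps ^+ absz (k%:Z - n%:Z)%R)%:~R * q ^+ jexp (k%:Z - n%:Z)).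
Proof.
have e2 : e * e = 1 by rewrite -intrM eps2.
(* The total power of q pulled out: b n^2 from the upper half, the rest from the lower half. *)
pose M := (b * n * n + a * n + b * 'C(n, 2))%N.
have := gauss_binomial (q ^+ b) (q ^+ (b * n)) (e * q ^+ a) n.*2.
rewrite -addnn big_split_ord /=.
have -> : \prod_(i < n) (q ^+ (b * n) + e * q ^+ a * (q ^+ b) ^+ (n + i)) =
   q ^+ (b * n * n) * \prod_(j < n) (1 + e * q ^+ (a + b * j)).
  have -> : q ^+ (b * n * n) = \prod_(j < n) q ^+ (b * n).
    by rewrite prodr_const card_ord -exprM.
  rewrite -big_split /=.
  apply: eq_bigr => j _; rewrite -exprM mulnDr !exprD; ring.
have -> : \prod_(i < n) (q ^+ (b * n) + e * q ^+ a * (q ^+ b) ^+ i) =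
   e ^+ n * q ^+ (a * n + b * 'C(n, 2)) * \prod_(j < n) (1 + e * q ^+ (b * j.+1 - a)).
  have -> : e ^+ n * q ^+ (a * n + b * 'C(n, 2)) = \prod_(i < n) (e * q ^+ (a + b * i)).
    elim: (n) => [|m IHm]; first by rewrite big_ord0 bin0n /= !muln0 !mulr1.
    rewrite big_ord_recr /= -IHm binS bin1 mulnS !mulnDr !exprD exprS; ring.
  rewrite [\prod_(i < n) (e * _)](reindex_inj rev_ord_inj) [LHS](reindex_inj rev_ord_inj) /=.
  rewrite -big_split /=; apply: eq_bigr => j _.
  rewrite mulrDr mulr1 -exprM -mulrA -exprD addrC; congr (_ + _).
  rewrite mulrACA e2 mul1r -exprD; congr (_ ^+ _).
  rewrite -{1}(subnK (ltn_ord j)) mulnDr.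
  have := leq_pmulr b (ltn0Sn j); lia.
move=> H; apply: (@qX_inj M); rewrite big_split /=.
have EE : e ^+ n * e ^+ n = 1 by rewrite -exprMn e2 expr1n.
transitivity ((e ^+ n * e ^+ n) * (q ^+ M * (\prod_(j < n) (1 + e * q ^+ (a + b * j)) *
    \prod_(j < n) (1 + e * q ^+ (b * j.+1 - a))))); first by rewrite EE mul1r.
rewrite /M -addnA exprD; transitivity (e ^+ n * (e ^+ n * q ^+ (a * n + b * 'C(n, 2)) *
  \prod_(j < n) (1 + e * q ^+ (b * j.+1 - a)) * (q ^+ (b * n * n) * \prod_(j < n) (1 + e * q
      ^+ (a + b * j))))).
  by ring.
rewrite {}H !mulr_sumr; apply: eq_bigr => k _; rewrite -exprD.
have kn : (k <= n + n)%N by rewrite -ltnS.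
(* Both exponents of [eps] have the same parity. *)
have -> : (eps ^+ absz (k%:Z - n%:Z)%R)%:~R = e ^+ n * e ^+ k.
  have -> : e ^+ n * e ^+ k = (eps ^+ (n + k))%:~R by rewrite -exprD rmorphXn.
  congr (_%:~R); have -> : (n + k = absz (k%:Z - n%:Z)%R + 2 * minn n k)%N by lia.
  by rewrite exprD exprM expr2 eps2 expr1n mulr1.
rewrite exprMn -!exprM.
transitivity (gbin (q ^+ b) (n + n) k * (e ^+ n * e ^+ k) *
  (q ^+ (b * 'C(k, 2)) * q ^+ (a * k) * q ^+ (b * n * (n + n - k)))); first by ring.
transitivity (gbin (q ^+ b) (n + n) k * (e ^+ n * e ^+ k) *
  (q ^+ (b * n * n + (a * n + b * 'C(n, 2))) * q ^+ jexp (k%:Z - n%:Z))); last by ring.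
congr (_ * _); rewrite -!exprD; congr (_ ^+ _).
have := jexpE (k%:Z - n%:Z); have := bin2_int k; have := bin2_int n => Cn Ck J.
have {}Cn := congr1 (fun x => b%:Z * x) Cn; have {}Ck := congr1 (fun x => b%:Z * x) Ck.
suff : 24 * (b * 'C(k, 2) + a * k + b * n * (n + n - k))%N%:Z =
   24 * (b * n * n + (a * n + b * 'C(n, 2)) + jexp (k%:Z - n%:Z))%N%:Z by lia.
have -> : (b * n * (n + n - k))%N = (b * n * absz (2 * n%:Z - k%:Z)%R)%N by congr (_ * _)%N;
    lia.
have K : (absz (2 * n%:Z - k%:Z)%R)%:Z = 2 * n%:Z - k%:Z by lia.
rewrite /= in Cn Ck; rewrite !PoszD !PoszM K; lia.
Qed.

(** The binomial at index k agrees with the inverse of [f_ b] only modulo q^(n+1-|k-n|), but it is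
    multiplied by q^(jexp(k-n)), and jexp(k-n) >= |k-n| makes up for the loss. *)
Lemma jtp n : eqm n.+1
  (f_ b * \prod_(j < n) ((1 + e * q ^+ (a + b * j)) * (1 + e * q ^+ (b * j.+1 - a))))
  (theta (fun i => eps ^+ absz i) (fun i => 12 * b%:Z * (i * (i - 1)) + 24 * a%:Z * i) 0).
Proof.
pose r := [seq k%:Z - n%:Z | k <- iota 0 n.*2.+1].
have ur : uniq r by rewrite map_inj_uniq ?iota_uniq // => x y /=; lia.
apply: eqm_trans (eqm_sym (theta_eqm _ (e := jexp) ur _ _)); first last.
- move=> i ilt; apply/mapP; exists (absz (i + n%:Z)%R); last by have := jexp_ge i; lia.
  by rewrite mem_iota; have := jexp_ge i; lia.
- by move=> i; rewrite jexpE addr0.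
rewrite jtp_finite mulr_sumr big_map -[iota 0 _]/(index_iota 0 n.*2.+1) big_mkord.
apply: eqm_sum => k _; rewrite mulrA [f_ b * _]mulrC.
rewrite [X in eqm _ (_ * X)]mulrC [X in eqm _ _ X]mulrC mulrCA.
apply: eqm_qX; rewrite -[X in eqm _ _ X]mul1r; apply: eqmM; last exact: eqm_refl.
have kn := ltn_ord k; have := jexp_ge (k%:Z - n%:Z) => J.
rewrite -[X in gbin _ X](subnKC (m := k)) -1?ltnS //.
by apply: gbin_f; lia.
Qed.

End JacobiTriple.

(** * Classical theta series *)

Section ClassicalThetas.

(** The sign (-1)^i of an integer, in a form suited to linear arithmetic. *)
Definition sg (i : int) : int := 1 - 2 * (i %% 2)%Z.

Lemma sg_absz i : (-1) ^+ absz i = sg i.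
Proof.
rewrite -signr_odd /sg; case E: (odd (absz i)) => /=; rewrite ?expr0 ?expr1; lia.
Qed.

Lemma theta_add (I : choiceType) (c E : I -> int) s d :
  theta c E s = theta c (fun i => E i + d) (s + d).
Proof.
apply: fpsP => N /=; apply: eq_fsbigl.
by apply/seteqP; split=> i /= H; lia.
Qed.

Lemma theta_opp (c E : int -> int) s :
  theta c E s = theta (fun i => c (- i)) (fun i => E (- i)) s.
Proof. by apply: (theta_bij (h := -%R)); exists -%R => i; rewrite opprK. Qed.

(** The index is negated so that the squares below take the shapes (6n+1)^2 and (4n+1)^2. *)
Lemma jtp_theta a b (eps : int) (c E : int -> int) s n :
  (0 < a)%N -> (a < b)%N -> eps * eps = 1 -> (forall i, eps ^+ absz i = c (- i)) ->
  (forall i, 12 * b%:Z * (i * (i - 1)) + 24 * a%:Z * i + s = E (- i)) ->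
  eqm n.+1 (f_ b * \prod_(j < n) ((1 + eps%:~R * q ^+ (a + b * j)) *
                                  (1 + eps%:~R * q ^+ (b * j.+1 - a))))
           (theta c E s).
Proof.
move=> a0 ab eps2 ce EE; rewrite theta_opp.
apply: eqm_trans (@jtp _ _ a0 ab _ eps2 n) _; rewrite (theta_add _ _ 0 s) add0r.
rewrite (eq_theta s ce EE); exact: eqm_refl.
Qed.

Lemma opp_q k : 1 + (-1)%:~R * q ^+ k = 1 - q ^+ k.
Proof. by rewrite mulN1r. Qed.

(** This is 24 n (3n+1) / 2 + 1, so pentagonal exponents become squares. *)
Definition penE (n : int) : int := (6 * n + 1) * (6 * n + 1).

(** The triple product with a = 1, b = 3: exponents 1 and 2 modulo 3, together with [f_ 3], rebuild
    [f_ 1]. *)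
Lemma euler_pentagonal : f_ 1 = theta sg penE 1.
Proof.
apply: eqm_all => N; apply: (@eqmW N.+1) => //.
have H := @jtp_theta 1 3 (-1) sg penE 1 N isT isT.
apply: eqm_trans (H _ _ _); first last.
- by move=> i; rewrite /penE; ring.
- by move=> i; rewrite sg_absz /sg; lia.
- by [].
have f3 := @f_eqm 3 N.+1 N isT (leqnn _).
have f1 := @f_eqm 1 N.+1 (3 * N) isT _.
apply: eqm_trans (f1 _) _; first by lia.
apply: eqm_trans (eqmM (eqm_sym f3) (@eqm_refl _ _)).
rewrite -big_split /=; set u := (X in eqm _ X _); set v := (X in eqm _ _ X).
suff -> : u = v by apply: eqm_refl.
rewrite /u /v; elim: (N) => [|n IHn]; first by rewrite !big_ord0.
rewrite mulnS addnC addn3 !big_ord_recr /= IHn -!mulrA; congr (_ * _).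
rewrite !opp_q !mul1n.
have -> : (1 + 3 * n = (3 * n).+1)%N by lia.
have -> : (3 * n.+1 - 1 = (3 * n).+2)%N by lia.
have -> : (3 * n.+1 = (3 * n).+3)%N by lia.
by ring.
Qed.

Definition oddq n : fps int := \prod_(j < n) (1 - q ^+ (j.*2.+1)).

Lemma oddq_f n N : (N <= n.+1)%N -> eqm N (oddq n * f_ 2) (f_ 1).
Proof.
move=> Nn; have f2 := @f_eqm 2 N n isT Nn.
apply: eqm_trans (eqmM (@eqm_refl _ _) f2) _; apply: eqm_sym.
apply: eqm_trans (@f_eqm 1 N n.*2 isT _) _; first by lia.
set u := (X in eqm _ X _); set v := (X in eqm _ _ X).
suff -> : u = v by apply: eqm_refl.
rewrite /u /v /oddq -big_split /=; elim: (n) => [|m IHm]; first by rewrite !big_ord0.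
rewrite doubleS !big_ord_recr /= IHm -!mulrA; congr (_ * (_ * _)); rewrite mul1n //.
by congr (1 - q ^+ _); lia.
Qed.

(* phi(-q) = f_1^2 / f_2 *)
Definition phim : fps int := theta sg (fun n => 24 * (n * n)) 0.

(** With a = 1, b = 2 both families of factors run over the odd exponents, so phi(-q) is [f_ 2]
    times the square of the odd product. *)
Lemma phim_f : phim * f_ 2 = f_ 1 ^+ 2.
Proof.
apply: eqm_all => N; apply: (@eqmW N.+1) => //.
have H := @jtp_theta 1 2 (-1) sg (fun n => 24 * (n * n)) 0 N isT isT.
apply: eqm_trans (eqmM (eqm_sym (H _ _ _)) (@eqm_refl _ _)) _.
- by [].
- by move=> i; rewrite sg_absz /sg; lia.
- by move=> i; ring.
rewrite (eq_bigr (fun j : 'I_N => (1 - q ^+ j.*2.+1) ^+ 2)) => [|j _].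
  rewrite prodrXl -/(oddq N) mulrAC mulrC mulrA -mulrA.
  rewrite (_ : _ * _ = (oddq N * f_ 2) ^+ 2); last by ring.
  exact/eqmX/oddq_f.
rewrite !opp_q expr2; congr ((1 - q ^+ _) * (1 - q ^+ _)); lia.
Qed.

(** This is 24 n (2n+1) + 3; as n runs over the integers, n (2n+1) meets each triangular number
    once. *)
Definition triE (n : int) : int := 3 * ((4 * n + 1) * (4 * n + 1)).

(* psi(q) = f_2^2 / f_1 and psi(-q) = f_1 f_4 / f_2 *)
Definition psi : fps int := theta (fun=> 1) triE 3.
Definition psim : fps int := theta sg triE 3.

Lemma psim_f : psim * f_ 2 = f_ 1 * f_ 4.
Proof.
apply: eqm_all => N; apply: (@eqmW N.+1) => //.
have H := @jtp_theta 1 4 (-1) sg triE 3 N isT isT.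
apply: eqm_trans (eqmM (eqm_sym (H _ _ _)) (@eqm_refl _ _)) _.
- by [].
- by move=> i; rewrite sg_absz /sg; lia.
- by move=> i; rewrite /triE; ring.
rewrite (_ : \prod_(j < N) _ = oddq N.*2).
  rewrite mulrAC mulrC [f_ 4 * _]mulrC mulrA [f_ 1 * _]mulrC [X in eqm _ _ X]mulrC.
  by apply: eqmM; [apply: oddq_f; lia|exact: eqm_refl].
rewrite /oddq; elim: (N) => [|n IHn]; first by rewrite !big_ord0.
rewrite doubleS !big_ord_recr /= IHn !opp_q -!mulrA.
by congr (_ * ((1 - q ^+ _) * (1 - q ^+ _))); lia.
Qed.

Lemma psi_f : psi * f_ 1 = f_ 2 ^+ 2.
Proof.
apply: eqm_all => N; apply: (@eqmW N.+1) => //.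
have H := @jtp_theta 1 4 1 (fun=> 1) triE 3 N isT isT.
apply: eqm_trans (eqmM (eqm_sym (H _ _ _)) (@eqm_refl _ _)) _.
- by [].
- by move=> i; rewrite expr1n.
- by move=> i; rewrite /triE; ring.
set P := \prod_(j < N) _.
(* The factors 1 + q^m and 1 - q^m, m odd, multiply to 1 - q^(2m). *)
have PO : P * oddq N.*2 = dil 2 (oddq N.*2).
  rewrite /P /oddq rmorph_prod /=; elim: (N) => [|n IHn]; first by rewrite !big_ord0 mul1r.
  rewrite doubleS !big_ord_recr /= -IHn !mul1r !rmorphB !rmorph1 !rmorphXn /= dil_q //.
  rewrite -!exprM.
  have -> : (1 + 4 * n = n.*2.*2.+1)%N by lia.
  have -> : (4 * n.+1 - 1 = n.*2.+1.*2.+1)%N by lia.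
  by rewrite !mul2n -!addnn !exprD; ring.
have oN : (N.+1 <= N.*2.+1)%N by lia.
apply: eqm_trans (eqmM (@eqm_refl _ _) (eqm_sym (oddq_f oN))) _.
rewrite (_ : _ * _ = f_ 2 * (P * oddq N.*2 * f_ 4)); last by ring.
rewrite PO expr2; apply: eqmM; first exact: eqm_refl.
have := dil_eqm (isT : (0 < 2)%N) (oddq_f oN).
by rewrite rmorphM /= !dil_f.
Qed.

End ClassicalThetas.

(** * Jacobi's expansion of f_1^3 *)

Section JacobiCube.

(* Differentiating the Gauss binomial theorem at the root z = -1 of its middle factor. *)
Lemma jacobi_finite n :
  q ^+ ('C(n, 2) + n * n + n) * qfact q n ^+ 2 =
  \sum_(k < n.*2.+2) (-1) ^+ (n + k).+1 *
     (q ^+ ('C(k, 2) + n * (n.*2.+1 - k)) * gbin q n.*2.+1 k) *+ k.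
Proof.
have := gauss_binomial (q%:P) ((q ^+ n)%:P) 'X n.*2.+1.
move/(congr1 (fun u : {poly fps int} => (u^`()).[-1])).
have -> : n.*2.+1 = (n + n.+1)%N by lia.
rewrite big_split_ord big_ord_recl /= addn0.
rewrite mulrA !derivM !hornerE /= -!rmorphXn /= !derivE !hornerE.
(* The middle factor vanishes at -1, so only the term in which it is differentiated survives. *)
have -> : q ^+ n + -1 * q ^+ n = 0 by rewrite mulN1r subrr.
rewrite !(mulr0, mul0r) add0r addr0 !horner_prod.
have -> : \prod_(i < n) ((q ^+ n)%:P + 'X * q%:P ^+ i).[-1] =
    (-1) ^+ n * q ^+ 'C(n, 2) * qfact q n.
  have -> : (-1) ^+ n * q ^+ 'C(n, 2) = \prod_(i < n) - q ^+ i.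
    elim: (n) => [|m IHm]; first by rewrite big_ord0 bin0n mulr1.
    by rewrite big_ord_recr /= -IHm binS bin1 exprD exprS; ring.
  rewrite [\prod_(i < n) - _](reindex_inj rev_ord_inj) [LHS](reindex_inj rev_ord_inj) /=.
  rewrite /qfact -big_split /=; apply: eq_bigr => j _.
  rewrite -rmorphXn /= !hornerE -{1}(subnK (ltn_ord j)) exprD; ring.
have -> : \prod_(i < n) ((q ^+ n)%:P + 'X * q%:P ^+ (n + bump 0 i)).[-1] =
    q ^+ (n * n) * qfact q n.
  have -> : q ^+ (n * n) = \prod_(i < n) q ^+ n by rewrite prodr_const card_ord -exprM.
  rewrite /qfact -big_split /=; apply: eq_bigr => j _.
  by rewrite /bump leq0n add1n -rmorphXn !hornerE exprD; ring.
rewrite raddf_sum /= horner_sum => H.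
have E1 : (-1) ^+ n * (-1) ^+ n = 1 :> fps int by rewrite -exprMn mulrNN mulr1 expr1n.
transitivity ((-1) ^+ n * ((-1) ^+ n * q ^+ 'C(n, 2) * qfact q n * q ^+ n *
    (q ^+ (n * n) * qfact q n))).
  rewrite !exprD -[LHS]mul1r -[in LHS]E1; ring.
rewrite {}H mulr_sumr; apply: eq_bigr => k _.
have -> : q%:P ^+ 'C(k, 2) * gbin q%:P (n + n.+1) k * 'X^k * (q ^+ n)%:P ^+ (n + n.+1 - k)
   = (q ^+ ('C(k, 2) + n * (n + n.+1 - k)) * gbin q (n + n.+1) k) *: 'X^k.
  rewrite -mul_polyC rmorphM /= gbin_rmorph /= exprD exprM rmorphM !rmorphXn /=; ring.
rewrite derivZ derivXn hornerZ hornerMn hornerXn.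
case: (nat_of_ord k) => [|m]; first by rewrite !mulr0n !mulr0.
rewrite [m.+1.-1]/=; set A := q ^+ _ * _.
have -> : (-1) ^+ (n + m.+1).+1 = (-1) ^+ n * (-1) ^+ m :> fps int.
  by rewrite addnS !exprS exprD; ring.
by rewrite !mulrnAr; congr (_ *+ _); ring.
Qed.

(** Equal to 24 m (m+1) / 2 + 3; each triangular number occurs twice, for m and -1-m. *)
Definition oddE (m : int) : int := 3 * ((2 * m + 1) * (2 * m + 1)).
Definition texp (m : int) : nat := absz ((m * (m + 1)) %/ 2)%Z.

Lemma texp_spec m : 2 * (texp m)%:Z = m * (m + 1).
Proof.
have [t E] := even_triangle (m + 1).
have {}E : m * (m + 1) = t * 2 by rewrite mulrC [RHS]mulrC -E; ring.
by rewrite /texp E mulzK //; nia.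
Qed.

Lemma good_oddE : good oddE 3.
Proof.
apply: good_int => i; last by rewrite /oddE; nia.
by exists (texp i)%:Z => //; have := texp_spec i; rewrite /oddE; lia.
Qed.

(** The reflection m -> -1-m preserves the exponent and flips the sign. This zero series serves
    below to change weights at no cost. *)
Lemma theta_oddE0 : theta sg oddE 3 = 0.
Proof.
apply: (theta_odd0 (h := fun i => -1 - i)) => i; first by ring.
- by rewrite /sg; lia.
- by rewrite /oddE; ring.
Qed.

Lemma jacobi_raw : f_ 1 ^+ 3 = theta (fun m => sg m * m) oddE 3.
Proof.
apply: eqm_all => N; apply: (@eqmW N.+1) => //.
(* [jacobi_finite] carries the weight k = m + N + 1 instead of m; the difference is a multiple of
   the zero series [theta_oddE0]. *)
pose c m := sg m * m + N.+1%:Z * sg m.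
have -> : theta (fun m => sg m * m) oddE 3 = theta c oddE 3.
  by rewrite thetaD ?thetaZ ?theta_oddE0 ?mulr0 ?addr0 //; apply: good_oddE.
pose r := [seq k%:Z - N.+1%:Z | k <- iota 0 N.*2.+2].
have ur : uniq r by rewrite map_inj_uniq ?iota_uniq // => x y /=; lia.
apply: eqm_trans (eqm_sym (theta_eqm _ (e := texp) ur _ _)); first last.
- move=> i ilt; have Ti := texp_spec i.
  apply/mapP; exists (absz (i + N.+1%:Z)%R); last by nia.
  by rewrite mem_iota; nia.
- by move=> i; have := texp_spec i; rewrite /oddE; lia.
rewrite big_map -[iota 0 _]/(index_iota 0 N.*2.+2) big_mkord.
have f1 := @f_qfact 1 N N.+1 isT (leqnn _); rewrite expr1 in f1.
apply: (@eqm_trans _ (f_ 1 * qfact q N ^+ 2)).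
  by rewrite exprS; apply: eqmM; [exact: eqm_refl|exact: eqmX].
set M := ('C(N, 2) + N * N + N)%N.
have -> : f_ 1 * qfact q N ^+ 2 = \sum_(k < N.*2.+2)
    q ^+ texp (k%:Z - N.+1%:Z) * ((c (k%:Z - N.+1%:Z))%:~R * (gbin q N.*2.+1 k * f_ 1)).
  apply: (@qX_inj M); rewrite mulrCA jacobi_finite !mulr_sumr.
  apply: eq_bigr => k _; have kN := ltn_ord k.
  have T := texp_spec (k%:Z - N.+1%:Z); have Ck := bin2_int k; have CN := bin2_int N.
  have -> : ('C(k, 2) + N * (N.*2.+1 - k) = M + texp (k%:Z - N.+1%:Z))%N.
    have -> : (N.*2.+1 - k)%N = absz (2 * N%:Z + 1 - k%:Z)%R by lia.
    have K : (absz (2 * N%:Z + 1 - k%:Z)%R)%:Z = 2 * N%:Z + 1 - k%:Z by lia.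
    suff : ('C(k, 2))%:Z + N%:Z * (absz (2 * N%:Z + 1 - k%:Z)%R)%:Z =
      ('C(N, 2))%:Z + N%:Z * N%:Z + N%:Z + (texp (k%:Z - N.+1%:Z))%:Z by rewrite /M; lia.
    by rewrite K; lia.
  have -> : c (k%:Z - N.+1%:Z) = (-1) ^+ (N + k).+1 * k%:Z.
    rewrite (_ : (-1) ^+ (N + k).+1 = sg (k%:Z - N.+1%:Z)); first by rewrite /c; ring.
    by rewrite -[LHS]/((-1) ^+ absz (N + k).+1%:Z) sg_absz /sg; lia.
  rewrite intrM rmorphXn /= exprD -[_ *+ k]mulr_natr; ring.
apply: eqm_sum => k _; rewrite [X in eqm _ _ X]mulrC.
apply: eqm_qX; rewrite -[X in eqm _ _ X]mulr1; apply: eqmM; first exact: eqm_refl.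
have kN := ltn_ord k; have T := texp_spec (k%:Z - N.+1%:Z).
rewrite -[X in gbin _ X](subnKC (m := k)) -1?ltnS // -[q in gbin q]expr1.
by apply: gbin_f => //; nia.
Qed.

Lemma good_triE : good triE 3.
Proof.
apply: good_int => i; last by rewrite /triE; nia.
by exists (i * (2 * i + 1)); [nia|rewrite /triE; ring].
Qed.

(** The indices 2n and -2n-1 share an exponent, and their weights 2n and 2n+1 add up to 4n+1. *)
Lemma jacobi_cube : f_ 1 ^+ 3 = theta (fun n => 4 * n + 1) triE 3.
Proof.
rewrite jacobi_raw (theta_split2 (h1 := fun n : int => 2 * n) (h2 := fun n : int => - 2 * n - 1)
   _ good_oddE).
- rewrite [RHS](eq_theta 3 (c' := fun n => 2 * n + (2 * n + 1)) (E' := triE)) //; last first.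
    by move=> i; ring.
  rewrite thetaD; last exact: good_triE.
  congr (_ + _); apply: eq_theta => i; rewrite /oddE /triE /=; try ring.
    have -> : sg (2 * i) = 1 by rewrite /sg; lia.
    by ring.
  have -> : sg (- 2 * i - 1) = -1 by rewrite /sg; lia.
  by ring.
- by move=> x y /=; lia.
- by move=> x y /=; lia.
- by move=> x y /=; lia.
- move=> i; have [E|E] : (i %% 2 = 0 \/ i %% 2 = 1)%Z by lia.
    by left; exists (i %/ 2)%Z => /=; lia.
  by right; exists (- ((i + 1)%R %/ 2)%Z) => /=; lia.
Qed.

End JacobiCube.

(** * Theta series of weight 3/2 *)

Section WeightThreeHalves.

Definition sqE (n : int) : int := 24 * (n * n).
Definition octE (n : int) : int := 8 * ((3 * n + 1) * (3 * n + 1)).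

Lemma good_penE : good penE 1.
Proof.
apply: good_int => i; last by rewrite /penE; nia.
have [j [->|->]] : exists j, i = 2 * j \/ i = 2 * j + 1 by exists (i %/ 2)%Z; lia.
- by exists (j * (6 * j + 1)); [nia|rewrite /penE; ring].
- by exists ((2 * j + 1) * (3 * j + 2)); [case: (lerP 0 j) => ?; nia|rewrite /penE; ring].
Qed.

Lemma good_sqE : good sqE 0.
Proof.
apply: good_int => i; last by rewrite /sqE; nia.
by exists (i * i); [nia|rewrite /sqE; ring].
Qed.

Lemma good_octE : good octE 8.
Proof.
apply: good_int => i; last by rewrite /octE; nia.
by exists (i * (3 * i + 2)); [nia|rewrite /octE; ring].
Qed.

Lemma sgP i : sg i = 1 \/ sg i = -1.
Proof. by rewrite /sg; lia. Qed.

Lemma sgD i j : sg (i + j) = sg i * sg j.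
Proof.
have : (i %% 2 = 0 \/ i %% 2 = 1)%Z /\ (j %% 2 = 0 \/ j %% 2 = 1)%Z by lia.
by rewrite /sg => -[[Ei|Ei] [Ej|Ej]]; rewrite Ei Ej; lia.
Qed.

Lemma fps_double_inj (a b : fps int) : a + a = b + b -> a = b.
Proof.
move=> ab; apply: fpsP => n.
have : coefs (a + a) n = coefs (b + b) n by rewrite ab.
have H (x y : int) : x + x = y + y -> x = y by lia.
by rewrite !coefsD; apply: H.
Qed.

Lemma dil_f1 p : (0 < p)%N -> dil p (f_ 1) = f_ p.
Proof. by move=> p0; rewrite dil_f // muln1. Qed.

(* f_1^5 / f_2^2 *)
Definition xser : fps int := theta (fun t => 6 * t + 1) penE 1.

(* Since theta sg oddE 3 = 0, the weight m of the double series may be replaced by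
   m + 2n, after which the sum splits according to m + 2n modulo 3. *)
Lemma xser_f : f_ 1 ^+ 3 * phim = f_ 2 * xser.
Proof.
have -> : f_ 1 ^+ 3 * phim =
    f_ 1 ^+ 3 * phim + theta sg oddE 3 * theta (fun n => sg n * (2 * n)) sqE 0.
  by rewrite theta_oddE0 mul0r addr0.
rewrite jacobi_raw !theta_mul ?good_oddE ?good_sqE //; try exact: good_oddE;
    try exact: good_sqE.
rewrite -thetaD; last exact: good_pair good_oddE good_sqE.
(* On each class of m + 2n modulo 3 these coordinates separate the variables; for the first one 3
   (2m+1)^2 + 24 n^2 becomes (6t+1)^2 + 2 (6n-1)^2. *)
rewrite (theta_split3 (h1 := fun x : int * int => (x.1 - 2 * x.2, x.2 + x.1))
  (h2 := fun x : int * int => (x.1 - 1 - 2 * x.2, x.2 + x.1))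
  (h3 := fun x : int * int => (x.1 + 1 - 2 * x.2, x.2 + x.1)) _
   (good_pair good_oddE good_sqE)); first last.
- move=> [m n]; have : ((m + 2 * n) %% 3 = 0 \/ (m + 2 * n) %% 3 = 1 \/ (m + 2 * n) %% 3 =
    2)%Z by lia.
  case=> [E|[E|E]].
  + by left; exists (((m + 2 * n)%R %/ 3)%Z, n - ((m + 2 * n)%R %/ 3)%Z); congr (_, _) => /=;
      lia.
  + by right; right; exists (((m + 2 * n)%R %/ 3)%Z, n - ((m + 2 * n)%R %/ 3)%Z);
      congr (_, _) => /=; lia.
  + by right; left; exists (((m + 2 * n)%R %/ 3)%Z + 1, n - ((m + 2 * n)%R %/ 3)%Z - 1);
      congr (_, _) => /=; lia.
- by move=> [a b] [c d] /= [? ?]; lia.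
- by move=> [a b] [c d] /= [? ?]; lia.
- by move=> [a b] [c d] /= [? ?]; lia.
- by move=> [a b] [c d] /= [? ?]; congr (_, _); lia.
- by move=> [a b] [c d] /= [? ?]; congr (_, _); lia.
- by move=> [a b] [c d] /= [? ?]; congr (_, _); lia.
(* The class of 1 cancels under n -> 1-n; the other two give weights 3t and 3t+1, with sum 6t+1. *)
rewrite [X in _ + X](theta_odd0 (h := fun x : int * int => (x.1, 1 - x.2))); first last.
- by move=> [t n] /=; rewrite /oddE /sqE; ring.
- move=> [t n] /=; rewrite !sgD.
  have -> : sg (- (2 * n)) = 1 by rewrite /sg; lia.
  have -> : sg (- (2 * (1 - n))) = 1 by rewrite /sg; lia.
  have -> : sg (- n) = sg n by rewrite /sg; lia.
  have -> : sg 1 = -1 by [].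
  by case: (sgP t) (sgP n) => [->|->] [->|->]; ring.
- by move=> [t n] /=; congr (_, _); ring.
rewrite addr0.
rewrite (theta_bij (h := fun x : int * int => (x.1, - x.2))); last first.
  by exists (fun x : int * int => (x.1, - x.2)) => -[a b] /=; rewrite opprK.
rewrite [X in _ + X](theta_bij (h := fun x : int * int => (- x.1, x.2))); last first.
  by exists (fun x : int * int => (- x.1, x.2)) => -[a b] /=; rewrite opprK.
have -> : f_ 2 * xser = theta (fun x : int * int => (6 * x.1 + 1) * sg x.2)
    (fun x => penE x.1 + 2 * penE x.2) 3.
  rewrite -(dil_f1 (p := 2)) // euler_pentagonal dil_theta //; last exact: good_penE.
  rewrite mulrC theta_mul //; first exact: good_penE.
  exact: (good_scale (p := 2) isT good_penE).
rewrite [RHS](eq_theta 3 (E' := fun x : int * int => penE x.1 + 2 * penE x.2)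
   (c' := fun x : int * int => 3 * x.1 * sg x.2 + (3 * x.1 + 1) * sg x.2)); last first.
- by [].
- by move=> x; ring.
rewrite [RHS]thetaD; last first.
  exact: (good_pair good_penE (good_scale (p := 2) isT good_penE)).
congr (_ + _); apply: eq_theta => -[t n] /=; try by rewrite /oddE /sqE /penE; ring.
- rewrite !sgD.
  have -> : sg (- (2 * - n)) = 1 by rewrite /sg; lia.
  have -> : sg (- n) = sg n by rewrite /sg; lia.
  by case: (sgP t) (sgP n) => [->|->] [->|->]; ring.
- rewrite !sgD.
  have -> : sg (- (2 * n)) = 1 by rewrite /sg; lia.
  have -> : sg (- t) = sg t by rewrite /sg; lia.
  have -> : sg (- 1) = -1 by [].
  by case: (sgP t) (sgP n) => [->|->] [->|->]; ring.
Qed.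

(* f_2^5 / f_1^2 *)
Definition yalt : fps int := theta (fun t => sg t * (3 * t + 1)) octE 8.

(** Same method as [xser_f]: a zero series changes the weight m into m + 2n + 1, and the sum is
    split by this quantity modulo 3. *)
Lemma yalt_f : f_ 2 ^+ 3 * psi = f_ 1 * yalt.
Proof.
have gO : good (fun m => 2 * oddE m) 6 := good_scale (p := 2) isT good_oddE.
have gOT := good_pair gO good_triE.
have gPO := good_pair good_penE good_octE.
have f23 : f_ 2 ^+ 3 = theta (fun m => sg m * m) (fun m => 2 * oddE m) 6.
  rewrite -(dil_f1 (p := 2)) // -rmorphXn /= jacobi_raw dil_theta //; exact: good_oddE.
have z : theta sg (fun m => 2 * oddE m) 6 = 0.
  by have := congr1 (dil 2) theta_oddE0; rewrite rmorph0 dil_theta //; apply: good_oddE.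
have -> : f_ 2 ^+ 3 * psi = f_ 2 ^+ 3 * psi +
    theta sg (fun m => 2 * oddE m) 6 * theta (fun n => 2 * n + 1) triE 3.
  by rewrite z mul0r addr0.
rewrite f23 euler_pentagonal !theta_mul //; try exact: good_triE; try exact: good_penE;
    try exact: good_octE.
rewrite -thetaD //.
rewrite (theta_split3 (h1 := fun x : int * int => (x.1 - 2 * x.2, x.2 + x.1))
  (h2 := fun x : int * int => (x.1 - 2 - 2 * x.2, x.2 + x.1))
  (h3 := fun x : int * int => (x.1 - 1 - 2 * x.2, x.2 + x.1)) _ gOT); first last.
- move=> [m n]; have : ((m + 2 * n + 1) %% 3 = 0 \/ (m + 2 * n + 1) %% 3 = 1 \/ (m + 2 * n +
    1) %% 3 = 2)%Z by lia.
  case=> [E|[E|E]].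
  + by right; right; exists (((m + 2 * n + 1)%R %/ 3)%Z, n - ((m + 2 * n + 1)%R %/ 3)%Z);
      congr (_, _) => /=; lia.
  + by left; exists (((m + 2 * n + 1)%R %/ 3)%Z, n - ((m + 2 * n + 1)%R %/ 3)%Z);
      congr (_, _) => /=; lia.
  + by right; left; exists (((m + 2 * n + 1)%R %/ 3)%Z + 1, n - ((m + 2 * n + 1)%R %/ 3)%Z -
      1); congr (_, _) => /=; lia.
- by move=> [a b] [c d] /= [? ?]; lia.
- by move=> [a b] [c d] /= [? ?]; lia.
- by move=> [a b] [c d] /= [? ?]; lia.
- by move=> [a b] [c d] /= [? ?]; congr (_, _); lia.
- by move=> [a b] [c d] /= [? ?]; congr (_, _); lia.
- by move=> [a b] [c d] /= [? ?]; congr (_, _); lia.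
(* On the class of 0 the weight 3t is odd in t. *)
rewrite [X in _ + X](theta_odd0 (h := fun x : int * int => (- x.1, x.2))); first last.
- by move=> [t n] /=; rewrite /oddE /triE; ring.
- move=> [t n] /=.
  have -> : sg (- t - 1 - 2 * n) = - sg t by rewrite /sg; lia.
  have -> : sg (t - 1 - 2 * n) = - sg t by rewrite /sg; lia.
  by ring.
- by move=> [t n] /=; congr (_, _); ring.
rewrite addr0.
(* The parity of the pentagonal index matches the two remaining classes. *)
rewrite [RHS](theta_split2 (h1 := fun x : int * int => (- 2 * x.2, x.1))
  (h2 := fun x : int * int => (2 * x.2 + 1, - x.1)) _ gPO); first last.
- move=> [n t]; have [E|E] : (n %% 2 = 0 \/ n %% 2 = 1)%Z by lia.
  + by left; exists (t, - (n %/ 2)%Z); congr (_, _) => /=; lia.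
  + by right; exists (- t, (n %/ 2)%Z); congr (_, _) => /=; lia.
- by move=> [a b] [c d] /= [? ?]; lia.
- by move=> [a b] [c d] /= [? ?]; congr (_, _); lia.
- by move=> [a b] [c d] /= [? ?]; congr (_, _); lia.
congr (_ + _); apply: eq_theta => -[t n] /=; try by rewrite /oddE /triE /penE /octE; ring.
- have -> : sg (t - 2 * n) = sg t by rewrite /sg; lia.
  have -> : sg (- 2 * n) = 1 by rewrite /sg; lia.
  by ring.
- have -> : sg (t - 2 - 2 * n) = sg t by rewrite /sg; lia.
  have -> : sg (2 * n + 1) = -1 by rewrite /sg; lia.
  have -> : sg (- t) = sg t by rewrite /sg; lia.
  by ring.
Qed.

(* phi(q) *)
Definition phip : fps int := theta (fun=> 1) sqE 0.

Definition yser : fps int := theta (fun t => 3 * t + 1) octE 8.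

Lemma alt_theta_sg (c E : int -> int) (z : int -> int) s :
  (forall i, 0 <= z i) -> (forall i, E i = 24 * z i + s) -> (forall i, sg (z i) = sg i) ->
  alt (theta c E s) = theta (fun i => sg i * c i) E s.
Proof.
move=> z0 Ez sz; rewrite (alt_theta c (e := fun i => absz (z i))); last first.
  by move=> i; have := z0 i; rewrite Ez; lia.
by apply: eq_theta => // i; rewrite sg_absz sz.
Qed.

Lemma sg_sqr i : sg i * sg i = 1.
Proof. by case: (sgP i) => ->. Qed.

Lemma alt_psi : alt psi = psim.
Proof.
rewrite /psi (alt_theta_sg _ (z := fun n => n * (2 * n + 1))).
- by apply: eq_theta => // i; rewrite mulr1.
- by move=> i; nia.
- by move=> i; rewrite /triE; ring.
- by move=> i; have [j [->|->]] : exists j, i = 2 * j \/ i = 2 * j + 1 by [exists (i %/ 2)%Z;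
    lia]; rewrite /sg; lia.
Qed.

Lemma alt_phim : alt phim = phip.
Proof.
rewrite /phim (alt_theta_sg _ (z := fun n => n * n)).
- by apply: eq_theta => // i; rewrite sg_sqr.
- by move=> i; nia.
- by move=> i; rewrite /sqE; ring.
- by move=> i; have [j [->|->]] : exists j, i = 2 * j \/ i = 2 * j + 1 by [exists (i %/ 2)%Z;
    lia]; rewrite /sg; lia.
Qed.

Lemma alt_yalt : alt yalt = yser.
Proof.
rewrite /yalt (alt_theta_sg _ (z := fun n => n * (3 * n + 2))).
- by apply: eq_theta => // i; rewrite mulrA sg_sqr mul1r.
- by move=> i; nia.
- by move=> i; rewrite /octE; ring.
- by move=> i; have [j [->|->]] : exists j, i = 2 * j \/ i = 2 * j + 1 by [exists (i %/ 2)%Z;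
    lia]; rewrite /sg; lia.
Qed.

Lemma alt_f2 : alt (f_ 2) = f_ 2.
Proof. by rewrite -(dil_f1 (p := 2)) // alt_dil2. Qed.

Lemma psim_alt_f1 : psim * alt (f_ 1) = f_ 2 ^+ 2.
Proof. by rewrite -alt_psi -rmorphM /= psi_f rmorphXn /= alt_f2. Qed.

Lemma dil_psi_f : dil 2 psi * f_ 2 = f_ 4 ^+ 2.
Proof. by have := congr1 (dil 2) psi_f; rewrite rmorphM rmorphXn /= !dil_f. Qed.

Lemma unit_fX n k : f_ n ^+ k \is a GRing.unit.
Proof. exact/unitrX/unit_f. Qed.

(** Replacing q by -q in [yalt_f] brings in f_1(-q), which is eliminated by psi(-q) f_1(-q) =
    f_2^2. *)
Lemma f1_sqr_psi : f_ 1 ^+ 2 * dil 2 psi = yser.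
Proof.
have Hy : f_ 2 ^+ 3 * psim = alt (f_ 1) * yser.
  have := congr1 alt yalt_f.
  by rewrite [LHS]rmorphM [RHS]rmorphM rmorphXn /= alt_f2 alt_psi alt_yalt.
apply: (mulIr (unit_fX 2 3)).
transitivity (f_ 1 ^+ 2 * (dil 2 psi * f_ 2) * f_ 2 ^+ 2); first by ring.
rewrite dil_psi_f; transitivity ((f_ 1 * f_ 4) ^+ 2 * f_ 2 ^+ 2); first by ring.
rewrite -psim_f; transitivity (psim * (f_ 2 ^+ 3 * psim) * f_ 2); first by ring.
rewrite Hy; transitivity ((psim * alt (f_ 1)) * yser * f_ 2); first by ring.
by rewrite psim_alt_f1; ring.
Qed.

(** Both sides equal f_2^5 / f_4^2: the right one by [xser_f] at q^2, the left one by phi(q) f_2 =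
    f_1(-q)^2 and f_1 f_1(-q) = f_2^3 / f_4. *)
Lemma f1_sqr_phip : f_ 1 ^+ 2 * phip = dil 2 xser.
Proof.
have Hp : phip * f_ 2 = alt (f_ 1) ^+ 2.
  by have := congr1 alt phim_f; rewrite rmorphM rmorphXn /= alt_f2 alt_phim.
have Hx : f_ 2 ^+ 3 * dil 2 phim = f_ 4 * dil 2 xser.
  by have := congr1 (dil 2) xser_f; rewrite [LHS]rmorphM [RHS]rmorphM rmorphXn /= !dil_f.
have Hf : dil 2 phim * f_ 4 = f_ 2 ^+ 2.
  by have := congr1 (dil 2) phim_f; rewrite rmorphM rmorphXn /= !dil_f.
apply: (mulrI (unit_fX 4 2)).
transitivity ((f_ 1 * f_ 4) ^+ 2 * phip); first by ring.
rewrite -psim_f; transitivity (psim ^+ 2 * (phip * f_ 2) * f_ 2); first by ring.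
rewrite Hp; transitivity ((psim * alt (f_ 1)) ^+ 2 * f_ 2); first by ring.
rewrite psim_alt_f1; transitivity (f_ 2 ^+ 3 * (f_ 2 ^+ 2)); first by ring.
rewrite -Hf; transitivity (f_ 4 * (f_ 2 ^+ 3 * dil 2 phim)); first by ring.
by rewrite Hx; ring.
Qed.

End WeightThreeHalves.

(** * A two-term formula for f_3^2 *)

Section SquareOfF3.

Lemma theta_oddE_psi : theta (fun=> 1) oddE 3 = psi + psi.
Proof.
rewrite (theta_split2 (h1 := fun n : int => 2 * n) (h2 := fun n : int => - 2 * n - 1)
   _ good_oddE).
- by congr (_ + _); apply: eq_theta => i //; rewrite /oddE /triE /=; ring.
- by move=> x y /=; lia.
- by move=> x y /=; lia.
- by move=> x y /=; lia.
- move=> i; have [E|E] : (i %% 2 = 0 \/ i %% 2 = 1)%Z by lia.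
    by left; exists (i %/ 2)%Z => /=; lia.
  by right; exists (- ((i + 1)%R %/ 2)%Z) => /=; lia.
Qed.

Lemma theta_split_mod3 (J : choiceType) (c E : int * J -> int) s : good E s ->
  theta c E s = theta (fun x : int * J => c (3 * x.1, x.2)) (fun x => E (3 * x.1, x.2)) s
    + theta (fun x : int * J => c (3 * x.1 + 1, x.2)) (fun x => E (3 * x.1 + 1, x.2)) s
    + theta (fun x : int * J => c (3 * x.1 - 1, x.2)) (fun x => E (3 * x.1 - 1, x.2)) s.
Proof.
move=> gE; rewrite (theta_split3 (h1 := fun x : int * J => (3 * x.1, x.2))
  (h2 := fun x : int * J => (3 * x.1 + 1, x.2))
  (h3 := fun x : int * J => (3 * x.1 - 1, x.2)) _ gE) //.
- by move=> [a b] [c' d] /= [? ->]; congr (_, _); lia.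
- by move=> [a b] [c' d] /= [? ->]; congr (_, _); lia.
- by move=> [a b] [c' d] /= [? ->]; congr (_, _); lia.
- by move=> [a b] [c' d] /= [? _]; lia.
- by move=> [a b] [c' d] /= [? _]; lia.
- by move=> [a b] [c' d] /= [? _]; lia.
move=> [i j]; have : (i %% 3 = 0 \/ i %% 3 = 1 \/ i %% 3 = 2)%Z by lia.
case=> [?|[?|?]].
- by left; exists ((i %/ 3)%Z, j); congr (_, _) => /=; lia.
- by right; left; exists ((i %/ 3)%Z, j); congr (_, _) => /=; lia.
- by right; right; exists ((i %/ 3)%Z + 1, j); congr (_, _) => /=; lia.
Qed.

Lemma theta_opp1 (J : choiceType) (c E : int * J -> int) s :
  theta c E s = theta (fun x : int * J => c (- x.1, x.2)) (fun x => E (- x.1, x.2)) s.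
Proof.
apply: (theta_bij (h := fun x : int * J => (- x.1, x.2))).
by exists (fun x : int * J => (- x.1, x.2)) => -[a b] /=; rewrite opprK.
Qed.

(** In the double series for f_3^2, index pairs of equal parity give [T1] and the others [- T2].
    Doubling the two products on the right and splitting modulo 3 gives 2 T1 + T3 and T3 + 2 T2, so
    [T3] cancels. *)
Lemma f3_sqr : f_ 3 ^+ 2 = dil 2 psi * dil 9 phip - q ^+ 2 * (phip * dil 18 psi).
Proof.
have g3 : good (fun n => 3 * penE n) 3 := good_scale (p := 3) isT good_penE.
have g2o : good (fun n => 2 * oddE n) 6 := good_scale (p := 2) isT good_oddE.
have g18o : good (fun n => 18 * oddE n) 54 := good_scale (p := 18) isT good_oddE.
have g9s : good (fun n => 9 * sqE n) 0 := good_scale (p := 9) isT good_sqE.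
pose T1 := theta (fun _ : int * int => 1)
  (fun x => 6 * ((6 * x.1 + 1) * (6 * x.1 + 1) + 36 * (x.2 * x.2))) 6.
pose T2 := theta (fun _ : int * int => 1)
  (fun x => 6 * ((6 * x.1 - 2) * (6 * x.1 - 2) + 9 * ((2 * x.2 + 1) * (2 * x.2 + 1)))) 6.
pose T3 := theta (fun _ : int * int => 1)
  (fun x => 54 * ((2 * x.1 + 1) * (2 * x.1 + 1)) + 216 * (x.2 * x.2)) 6.
have H3 : f_ 3 ^+ 2 = T1 - T2.
  rewrite -(dil_f1 (p := 3)) // euler_pentagonal dil_theta //; last exact: good_penE.
  rewrite expr2 theta_mul //; try exact: g3.
  rewrite (theta_split2 (h1 := fun x : int * int => (x.1 + x.2, x.1 - x.2))
    (h2 := fun x : int * int => (x.1 + x.2, x.1 - x.2 - 1)) _ (good_pair g3 g3)).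
  - congr (_ + _).
      apply: eq_theta => -[i j] /=; last by rewrite /penE; ring.
      have -> : sg (i - j) = sg (i + j) by rewrite /sg; lia.
      exact: sg_sqr.
    have -> : - T2 = (-1)%:~R * T2 by rewrite mulN1r.
    rewrite /T2 -thetaZ.
    apply: eq_theta => -[i j] /=; last by rewrite /penE; ring.
    have -> : sg (i - j - 1) = - sg (i + j) by rewrite /sg; lia.
    by rewrite mulrN sg_sqr.
  - by move=> [a b] [c d] /= [? ?]; congr (_, _); lia.
  - by move=> [a b] [c d] /= [? ?]; congr (_, _); lia.
  - by move=> [a b] [c d] /= [? ?]; lia.
  - move=> [m n]; have [E|E] : ((m + n) %% 2 = 0 \/ (m + n) %% 2 = 1)%Z by lia.
    + left; exists (((m + n)%R %/ 2)%Z, m - ((m + n)%R %/ 2)%Z).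
      by congr (_, _) => /=; lia.
    + right; exists (((m + n)%R %/ 2)%Z + 1, m - ((m + n)%R %/ 2)%Z - 1).
      by congr (_, _) => /=; lia.
have HA : dil 2 psi * dil 9 phip + dil 2 psi * dil 9 phip = T1 + T3 + T1.
  rewrite -mulrDl -rmorphD /= -theta_oddE_psi !dil_theta //; try exact: good_oddE;
      try exact: good_sqE.
  rewrite theta_mul // theta_split_mod3; last exact: good_pair g2o g9s.
  congr (_ + _ + _); last rewrite theta_opp1; apply: eq_theta => -[i j] //=;
    rewrite /oddE /sqE; lia.
have HB : q ^+ 2 * (phip * dil 18 psi) + q ^+ 2 * (phip * dil 18 psi) = T3 + T2 + T2.
  rewrite -mulrDr -mulrDr -rmorphD /= -theta_oddE_psi !dil_theta //; try exact: good_oddE.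
  rewrite theta_mul //; last exact: good_sqE.
  rewrite theta_shift; last exact: good_pair good_sqE g18o.
  rewrite theta_split_mod3; last first.
    have [adm fin] := good_pair good_sqE g18o; split=> // x.
    by have [N ->] := adm x; exists (N + 2)%N; lia.
  rewrite -!addrA; congr (_ + _).
    rewrite (theta_bij (h := fun x : int * int => (x.2, x.1))); last first.
      by exists (fun x : int * int => (x.2, x.1)) => -[].
    by apply: eq_theta => -[i j] //=; rewrite /oddE /sqE; lia.
  congr (_ + _); first rewrite theta_opp1; apply: eq_theta => -[i j] //=;
    rewrite /oddE /sqE; lia.
apply: fps_double_inj; rewrite H3.
transitivity ((T1 + T3 + T1) - (T3 + T2 + T2)); first by ring.
by rewrite -HA -HB; ring.
Qed.

End SquareOfF3.

(** * The action of U_p *)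

Section Anisotropy.

(** Anisotropy of A x^2 + B y^2 modulo p as a boolean, so that each instance is settled by
    evaluation. *)
Definition anisob (p A B : nat) : bool :=
  all (fun a => all (fun b => (p %| A * (a * a) + B * (b * b))%N ==> (a == 0%N) && (b == 0%N))
    (iota 0 p)) (iota 0 p).

Lemma aniso p A B : (0 < p)%N -> anisob p A B -> forall (x y z : int),
  A%:Z * (x * x) + B%:Z * (y * y) = p%:Z * z -> (p%:Z %| x)%Z /\ (p%:Z %| y)%Z.
Proof.
move=> p_gt0 chk x y z E.
have res (w : int) : exists k (a : nat), w = p%:Z * k + a%:Z /\ (a < p)%N.
  exists (w %/ p%:Z)%Z, (absz (w %% p%:Z)%Z); split; last by lia.
  have := divz_eq w p%:Z; lia.
have [k [a [Ex ap]]] := res x; have [l [b [Ey bp]]] := res y.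
have pAB : (p %| A * (a * a) + B * (b * b))%N.
  suff : (p%:Z %| (A * (a * a) + B * (b * b))%N%:Z)%Z by [].
  apply/dvdzP; exists (z - A%:Z * (p%:Z * k * k + 2 * k * a%:Z) - B%:Z * (p%:Z * l * l + 2 *
      l * b%:Z)).
  rewrite !PoszD !PoszM mulrBl mulrBl [z * _]mulrC -E Ex Ey; ring.
move/allP/(_ a): chk; rewrite mem_iota add0n ap => /(_ isT) /allP /(_ b).
rewrite mem_iota add0n bp => /(_ isT); rewrite pAB /= => /andP[/eqP a0 /eqP b0].
by rewrite Ex Ey a0 b0 !addr0 !dvdz_mulr.
Qed.

End Anisotropy.

(** * Multiplication by p on theta series and Newman's relations *)

Section Newman.

(* h realises multiplication by +-p on the progression L i, on which E is a multiple of L^2. *)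
Record hecke (p : nat) (L h : int -> int) (k : int) (c E : int -> int) : Prop := Hecke {
  hecke_inj : injective h;
  hecke_E : forall j, E (h j) = p%:Z * (p%:Z * E j);
  hecke_c : forall j, c (h j) = k * c j;
  hecke_surj : forall i, (p%:Z %| L i)%Z -> exists j, i = h j }.

Lemma hecke_scale p L h k c E w : hecke p L h k c E -> hecke p L h k c (fun i => w * E i).
Proof. by case=> hi hE hc hs; split=> // j; rewrite hE; ring. Qed.

Lemma sect_hecke p r u L h k c E s : (0 < p)%N -> good E s -> hecke p L h k c E ->
  24 * (p%:Z * u%:Z + r%:Z) = (p%:Z * p%:Z - 1) * s ->
  (forall i N, E i = p%:Z * (24 * N + p%:Z * s) -> (p%:Z %| L i)%Z) ->
  sect p r (theta c E s) = k%:~R * (q ^+ u * dil p (theta c E s)).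
Proof.
move=> p0 gE [hi hE hc hs] su an; apply: (sect_theta p0 gE su hi) => // i N Ei.
exact/hs/(an _ _ Ei).
Qed.

(** The last hypothesis, supplied by anisotropy, makes p divide both linear forms, so the pair of
    maps [h1], [h2] reaches every contributing index. *)
Lemma sect_hecke2 p r u s (L1 h1 c1 E1 L2 h2 c2 E2 : int -> int) (k k1 k2 : int) :
  k = k1 * k2 -> (0 < p)%N -> good (fun x : int * int => E1 x.1 + E2 x.2) s ->
  hecke p L1 h1 k1 c1 E1 -> hecke p L2 h2 k2 c2 E2 ->
  24 * (p%:Z * u%:Z + r%:Z) = (p%:Z * p%:Z - 1) * s ->
  (forall i j N, E1 i + E2 j = p%:Z * (24 * N + p%:Z * s) ->
     (p%:Z %| L1 i)%Z /\ (p%:Z %| L2 j)%Z) ->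
  let T := theta (fun x : int * int => c1 x.1 * c2 x.2) (fun x => E1 x.1 + E2 x.2) s in
  sect p r T = k%:~R * (q ^+ u * dil p T).
Proof.
move=> -> p0 gE [i1 hE1 hc1 hs1] [i2 hE2 hc2 hs2] su an T.
apply: (sect_theta (h := fun x : int * int => (h1 x.1, h2 x.2)) p0 gE su).
- by move=> [a b] [c d] /= [/i1 -> /i2 ->].
- move=> [i j] N /= /an[/hs1[i' ->] /hs2[j' ->]].
  by exists (i', j').
- by move=> [i j] /=; rewrite hE1 hE2; ring.
- by move=> [i j] /=; rewrite hc1 hc2; ring.
Qed.

Definition newman p r u (k : int) (F : fps int) :=
  sect p r F = k%:~R * (q ^+ u * dil p F).

(** The inverse of F(q^p) is a series in q^p, hence passes through the section and becomes the
    inverse of F, next to k q^u F(q^p). *)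
Lemma coefs_newman p r u k F n : (r < p)%N -> F \is a GRing.unit -> newman p r u k F ->
  coefs (F / dil p F) (p * n + (p * u + r)) = k * coefs (dil p F / F) n.
Proof.
move=> rp UF HF; rewrite -rmorphV //.
have -> : (p * n + (p * u + r) = p * (n + u) + r)%N by lia.
rewrite -[LHS]/(coefs (sect p r (F * dil p F^-1)) (n + u)) sect_Mdil // HF.
by rewrite -!mulrA coefsMz coefs_qXM ltnNge leq_addl addnK.
Qed.

Definition penL (n : int) : int := 6 * n + 1.
Definition triL (n : int) : int := 4 * n + 1.

Ltac hecke_tac w :=
  split; [by move=> x y /=; lia|by move=> j; rewrite /penE /triE /sqE /octE; ring|
    by move=> j; rewrite /sg; lia|
    let i := fresh "i" in intro i; rewrite /penL /triL => /dvdzP[z ?]; exists (w i); lia].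

(** In this family [h] solves L(h j) = p L(j) or -p L(j), the sign being the one that keeps L(h j)
    in its progression. The constant is the parity sign of [h], or 1, or this signed p for the
    linear weights. *)
Lemma hecke_pen5 : hecke 5 penL (fun n => - 5 * n - 1) (-1) sg penE.
Proof. hecke_tac (fun i : int => - ((i + 1)%R %/ 5)%Z). Qed.
Lemma hecke_pen7 : hecke 7 penL (fun n => 7 * n + 1) (-1) sg penE.
Proof. hecke_tac (fun i : int => ((i - 1)%R %/ 7)%Z). Qed.
Lemma hecke_pen11 : hecke 11 penL (fun n => - 11 * n - 2) 1 sg penE.
Proof. hecke_tac (fun i : int => - ((i + 2)%R %/ 11)%Z). Qed.
Lemma hecke_tri3 : hecke 3 triL (fun n => - 3 * n - 1) (-3) (fun n => 4 * n + 1) triE.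
Proof. hecke_tac (fun i : int => - ((i + 1)%R %/ 3)%Z). Qed.
Lemma hecke_tri5 : hecke 5 triL (fun n => 5 * n + 1) 5 (fun n => 4 * n + 1) triE.
Proof. hecke_tac (fun i : int => ((i - 1)%R %/ 5)%Z). Qed.
Lemma hecke_tri7 : hecke 7 triL (fun n => - 7 * n - 2) (-7) (fun n => 4 * n + 1) triE.
Proof. hecke_tac (fun i : int => - ((i + 2)%R %/ 7)%Z). Qed.
Lemma hecke_psim3 : hecke 3 triL (fun n => - 3 * n - 1) (-1) sg triE.
Proof. hecke_tac (fun i : int => - ((i + 1)%R %/ 3)%Z). Qed.
Lemma hecke_psi3 : hecke 3 triL (fun n => - 3 * n - 1) 1 (fun=> 1) triE.
Proof. hecke_tac (fun i : int => - ((i + 1)%R %/ 3)%Z). Qed.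
Lemma hecke_psi5 : hecke 5 triL (fun n => 5 * n + 1) 1 (fun=> 1) triE.
Proof. hecke_tac (fun i : int => ((i - 1)%R %/ 5)%Z). Qed.
Lemma hecke_phim3 : hecke 3 id (fun n => 3 * n) 1 sg sqE.
Proof. hecke_tac (fun i : int => (i %/ 3)%Z). Qed.
Lemma hecke_phip5 : hecke 5 id (fun n => 5 * n) 1 (fun=> 1) sqE.
Proof. hecke_tac (fun i : int => (i %/ 5)%Z). Qed.
Lemma hecke_oct5 : hecke 5 (fun n => 3 * n + 1) (fun n => - 5 * n - 2) (-5) (fun n => 3 * n +
    1) octE.
Proof. hecke_tac (fun i : int => - ((i + 2)%R %/ 5)%Z). Qed.
Lemma hecke_xser5 : hecke 5 penL (fun n => - 5 * n - 1) (-5) (fun n => 6 * n + 1) penE.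
Proof. hecke_tac (fun i : int => - ((i + 1)%R %/ 5)%Z). Qed.

Lemma f_theta l : (0 < l)%N -> f_ l = theta sg (fun n => l%:Z * penE n) l%:Z.
Proof.
move=> l0; rewrite -(dil_f1 l0) euler_pentagonal dil_theta // ?mulr1 //; exact: good_penE.
Qed.

Lemma f_cube_theta l : (0 < l)%N ->
  f_ l ^+ 3 = theta (fun n => 4 * n + 1) (fun n => l%:Z * triE n) (l%:Z * 3).
Proof.
move=> l0; rewrite -(dil_f1 l0) -rmorphXn /= jacobi_cube dil_theta //; exact: good_triE.
Qed.

Lemma good_pen_pair l : (0 < l)%N ->
  good (fun x : int * int => penE x.1 + l%:Z * penE x.2) (1 + l%:Z).
Proof.
move=> l0; have := good_pair good_penE (good_scale l0 good_penE).
by rewrite mulr1.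
Qed.

(** The exponents are values of x^2 + l y^2 at x = 6i+1, y = 6j+1, and each factor contributes one
    constant k. *)
Lemma newman_ff p r u h k K l : K = k * k -> (0 < p)%N -> (0 < l)%N -> hecke p penL h k sg
    penE ->
  anisob p 1 l -> 24 * (p%:Z * u%:Z + r%:Z) = (p%:Z * p%:Z - 1) * (1 + l%:Z) ->
  newman p r u K (f_ 1 * f_ l).
Proof.
move=> EK p0 l0 H an su; rewrite /newman (f_theta l0) euler_pentagonal theta_mul; first last.
- by have := good_scale l0 good_penE; rewrite mulr1.
- exact: good_penE.
apply: (sect_hecke2 EK p0 (good_pen_pair l0) H (hecke_scale l%:Z H) su) => i j N E.
by apply: (aniso p0 an (z := 24 * N + p%:Z * (1 + l%:Z))); rewrite -E mul1r.
Qed.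

Lemma newman_cc p r u h k K l : K = k * k -> (0 < p)%N -> (0 < l)%N ->
  hecke p triL h k (fun n => 4 * n + 1) triE ->
  anisob p 1 l -> 24 * (p%:Z * u%:Z + r%:Z) = (p%:Z * p%:Z - 1) * (3 + l%:Z * 3) ->
  newman p r u K (f_ 1 ^+ 3 * f_ l ^+ 3).
Proof.
move=> EK p0 l0 H an su; rewrite /newman (f_cube_theta l0) jacobi_cube.
have gl := good_scale l0 good_triE; rewrite theta_mul //; last exact: good_triE.
apply: (sect_hecke2 EK p0 (good_pair good_triE gl) H (hecke_scale l%:Z H) su) => i j N E.
(* The factor 3 common to both exponents has been divided out. *)
apply: (aniso p0 an (z := 8 * N + p%:Z * (1 + l%:Z))).
by rewrite /triE /triL in E *; lia.
Qed.

Lemma newman_c p r u h k B : (0 < p)%N -> hecke p triL h k (fun n => 4 * n + 1) triE ->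
  anisob p 1 B -> 24 * (p%:Z * u%:Z + r%:Z) = (p%:Z * p%:Z - 1) * 3 ->
  newman p r u k (f_ 1 ^+ 3).
Proof.
move=> p0 H an su; rewrite /newman jacobi_cube.
apply: (sect_hecke p0 good_triE H su) => i N E.
(* A single square is read as a binary form at y = 0. *)
have [] // := aniso p0 an (x := triL i) (y := 0) (z := 8 * N + p%:Z).
by rewrite /triE /triL in E *; lia.
Qed.

End Newman.

(** * Dissections *)

Section SpecialCases.

(** Euler's series would give x^2 + 2 y^2, which is isotropic modulo 3; this factorisation leads to
    x^2 + 16 y^2, which is not. *)
Lemma f1f2_psim_phim : f_ 1 * f_ 2 = psim * dil 2 phim.
Proof.
have Hf : dil 2 phim * f_ 4 = f_ 2 ^+ 2.
  by have := congr1 (dil 2) phim_f; rewrite rmorphM rmorphXn /= !dil_f.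
apply: (mulIr (unit_f 4)); apply: (mulIr (unit_f 2)).
transitivity (f_ 1 * f_ 4 * f_ 2 ^+ 2); first by ring.
by rewrite -psim_f -Hf; ring.
Qed.

Lemma newman_f1f2_3 : newman 3 1 0 (-1) (f_ 1 * f_ 2).
Proof.
rewrite /newman f1f2_psim_phim dil_theta //; last exact: good_sqE.
have gS := good_scale (p := 2) isT good_sqE; rewrite theta_mul //; last exact: good_triE.
apply: (sect_hecke2 (p := 3) (k := -1) (k1 := -1) (k2 := 1) erefl isT (good_pair good_triE
    gS) hecke_psim3
   (hecke_scale 2%:Z hecke_phim3)) => // i j N E.
apply: (@aniso 3 1 16 isT isT _ _ (8 * N + 3)).
by rewrite /triE /sqE /triL in E *; lia.
Qed.

Lemma f1f3_sqr : f_ 1 ^+ 2 * f_ 3 ^+ 2 =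
  yser * dil 9 phip - q ^+ 2 * (dil 2 xser * dil 18 psi).
Proof. by rewrite f3_sqr -f1_sqr_psi -f1_sqr_phip; ring. Qed.

Lemma sectB p r (a b : fps int) : sect p r (a - b) = sect p r a - sect p r b.
Proof. exact: fpsP. Qed.

(** The two binary theta series of [f1f3_sqr] satisfy the relation separately, with the same
    constant: -5 from the linear weight and 1 from the other factor. *)
Lemma newman_f1f3_sqr : newman 5 3 1 (-5) (f_ 1 ^+ 2 * f_ 3 ^+ 2).
Proof.
rewrite /newman f1f3_sqr !dil_theta //; try exact: good_sqE; try exact: good_penE;
    try exact: good_triE.
have g9 := good_scale (p := 9) isT good_sqE.
have g2 := good_scale (p := 2) isT good_penE.
have g18 := good_scale (p := 18) isT good_triE.
rewrite !theta_mul //; try exact: good_octE.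
rewrite theta_shift; last exact: (good_pair g2 g18).
(* The factor q^2 lowers s from 2 + 54 to 8, the value for the first series, so both share r = 3 and
   u = 1. *)
have gB : good (fun x : int * int => 2%:Z * penE x.1 + 18%:Z * triE x.2) 8.
  have [adm fin] := good_pair g2 g18; split=> // x.
  by have [N ->] := adm x; exists (N + 2)%N; lia.
rewrite sectB rmorphB /= !mulrBr; congr (_ - _).
- apply: (sect_hecke2 (p := 5) (k := -5) (k1 := -5) (k2 := 1) erefl isT (good_pair good_octE
    g9) hecke_oct5
   (hecke_scale 9%:Z hecke_phip5)) => // i j N E.
  apply: (@aniso 5 8 216 isT isT _ _ (24 * N + 40)).
  by rewrite /octE /sqE in E *; lia.
- apply: (sect_hecke2 (p := 5) (k := -5) (k1 := -5) (k2 := 1) erefl isT gB (hecke_scale 2%:Z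
    hecke_xser5)
   (hecke_scale 18%:Z hecke_psi5)) => // i j N E.
  apply: (@aniso 5 2 54 isT isT _ _ (24 * N + 40)).
  by rewrite /penE /triE /penL /triL in E *; lia.
Qed.

End SpecialCases.

(** * Dissections of f_1 modulo 5 and of f_1 f_2 modulo 3 *)

Section Dissections.

Lemma sectMz p r (z : int) (a : fps int) : sect p r (z%:~R * a) = z%:~R * sect p r a.
Proof.
by apply: fpsP => n; rewrite -[LHS]/(coefs (z%:~R * a) (p * n + r)) !coefsMz.
Qed.

Lemma sect_sum p r I (s : seq I) (F : I -> fps int) :
  sect p r (\sum_(i <- s) F i) = \sum_(i <- s) sect p r (F i).
Proof.
by apply: fpsP => n; rewrite -[LHS]/(coefs (\sum_(i <- s) F i) (p * n + r)) !coefs_sum.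
Qed.

(* If f = g(q^p) P(t) with t = q r(q^p), then the powers of t in P^K lie in distinct
   residue classes, so that a section of f^K only picks coefficients of P^K. *)
Lemma newman_dissection p s u k K (f g r P : fps int) (cs : seq int) : (s < p)%N ->
  f = dil p g * P -> dil p f = g * r ->
  P ^+ K = \sum_(j <- iota 0 (size cs)) (cs`_j)%:~R * (q * dil p r) ^+ j ->
  (\sum_(j <- [seq j <- iota 0 (size cs) | (j %% p == s)%N])
     (cs`_j)%:~R * (q ^+ (j %/ p) * (g ^+ K * r ^+ j)) = k%:~R * (q ^+ u * (g * r) ^+ K)) ->
  newman p s u k (f ^+ K).
Proof.
move=> sp Ef Efd EP Es; rewrite /newman rmorphXn /= Efd -Es {1}Ef exprMn EP mulr_sumr sect_sum.
rewrite big_filter [RHS]big_mkcond; apply: eq_bigr => j _.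
rewrite mulrCA sectMz exprMn -!rmorphXn /= mulrCA -rmorphM /= sect_qXdil //.
by case: ifP => // _; rewrite mulr0.
Qed.

Lemma sqr_mod5 (x N : int) : x * x <> 5 * N + 2 /\ x * x <> 5 * N + 3.
Proof.
have Ex := divz_eq x 5; set k := (x %/ 5)%Z in Ex.
have [->|[->|[->|[->|->]]]] : x = 5 * k \/ x = 5 * k + 1 \/ x = 5 * k + 2
    \/ x = 5 * k + 3 \/ x = 5 * k + 4 by lia.
all: lia.
Qed.

Lemma sqr_mod3 (x N : int) : x * x <> 3 * N + 2.
Proof.
have Ex := divz_eq x 3; set k := (x %/ 3)%Z in Ex.
have [->|[->|->]] : x = 3 * k \/ x = 3 * k + 1 \/ x = 3 * k + 2 by lia.
all: lia.
Qed.

Lemma sect1_f1_5 : sect 5 1 (f_ 1) = - f_ 5.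
Proof.
have -> : - f_ 5 = (-1)%:~R * (q ^+ 0 * dil 5 (f_ 1)) by rewrite dil_f1 // mulN1r mul1r.
rewrite euler_pentagonal; apply: (sect_hecke (p := 5) isT good_penE hecke_pen5) => // i N E.
have [] // := @aniso 5 1 2 isT isT (penL i) 0 (24 * N + 5).
by rewrite /penE /penL in E *; lia.
Qed.

Lemma dissection5 : exists g r : fps int,
  f_ 1 = dil 5 g * (1 - q * dil 5 r - (q * dil 5 r) ^+ 2) /\ dil 5 (f_ 1) = g * r.
Proof.
have s3 : sect 5 3 (f_ 1) = 0.
  rewrite euler_pentagonal; apply: sect_theta0 => i N E.
  by have := (sqr_mod5 (6 * i + 1) (24 * N + 14)).2; rewrite /penE in E; lia.
have s4 : sect 5 4 (f_ 1) = 0.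
  rewrite euler_pentagonal; apply: sect_theta0 => i N E.
  by have := (sqr_mod5 (6 * i + 1) (24 * N + 19)).1; rewrite /penE in E; lia.
(* An exponent 5N+2 would require (4i+1)^2 = 5 (8N+3) + 2, a non-residue modulo 5. *)
have c2 : sect 5 2 (f_ 1 ^+ 3) = 0.
  rewrite jacobi_cube; apply: sect_theta0 => i N E.
  by have := (sqr_mod5 (4 * i + 1) (8 * N + 3)).1; rewrite /triE in E; lia.
set a := sect 5 0 (f_ 1); set b := sect 5 2 (f_ 1).
have Ua : a \is a GRing.unit.
  by apply: unit_coefs0; rewrite /= big_geq // coef1.
have F : f_ 1 = dil 5 a - q * dil 5 (f_ 5) + q ^+ 2 * dil 5 b.
  rewrite {1}(sect_decomp (p := 5) (f_ 1)) // !big_ord_recl big_ord0 /= /bump /=.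
  by rewrite sect1_f1_5 s3 s4 rmorph0 rmorphN /=; ring.
have ab : a * b = - f_ 5 ^+ 2.
  have E3 : f_ 1 ^+ 3 = q ^+ 0 * dil 5 (a ^+ 3) + q ^+ 1 * dil 5 (- 3%:~R * (a ^+ 2 * f_ 5))
      + q ^+ 2 * dil 5 (3%:~R * (a * (f_ 5 ^+ 2 + a * b)))
      + q ^+ 3 * dil 5 (- f_ 5 ^+ 3 - 6%:~R * (a * b * f_ 5))
      + q ^+ 4 * dil 5 (3%:~R * (f_ 5 ^+ 2 * b + a * b ^+ 2))
      + q ^+ 5 * dil 5 (- 3%:~R * (f_ 5 * b ^+ 2)) + q ^+ 6 * dil 5 (b ^+ 3).
    rewrite {1}F !(rmorphD, rmorphB, rmorphN, rmorphM, rmorphXn, rmorph_int) /=; ring.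
  (* Only the q^2 term lies in class 2, so a (f_5^2 + a b) vanishes and the unit [a] cancels. *)
  move: c2; rewrite E3 !sectD !sect_qXdil //= !(add0r, addr0) mul1r => H.
  have {}H : a * (f_ 5 ^+ 2 + a * b) = a * 0.
    rewrite mulr0; apply: fpsP => n.
    have : coefs (3%:~R * (a * (f_ 5 ^+ 2 + a * b))) n = 0 by rewrite H.
    by rewrite coefsMz => /eqP; rewrite mulf_eq0 => /orP[//|/eqP].
  have {}H := mulrI Ua H.
  by apply/eqP; rewrite -addr_eq0 addrC H.
(* Since a b = - f_5^2, the single quotient r = f_5 / a expresses both remaining components. *)
have [r ar] : exists r, a * r = f_ 5 by exists (f_ 5 / a); rewrite mulrCA divrr ?mulr1.
exists a, r; split; last by rewrite ar dil_f.
have br : b = - (a * r ^+ 2).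
  by apply: (mulrI Ua); rewrite ab mulrN mulrA -expr2 -exprMn ar.
rewrite {1}F br -ar rmorphN /= [dil 5 (a * r)]rmorphM [dil 5 (a * _)]rmorphM rmorphXn /=.
by ring.
Qed.

Lemma f1f2_phim_psi : f_ 1 * f_ 2 = phim * psi.
Proof.
apply: (mulIr (unit_f 1)); apply: (mulIr (unit_f 2)).
transitivity (f_ 1 ^+ 2 * f_ 2 ^+ 2); first by ring.
by rewrite -psi_f -phim_f; ring.
Qed.

(** phi(-q) and psi(q) have no exponents 2 modulo 3, so their product has three terms;
    [newman_f1f2_3] then fixes the middle one. *)
Lemma dissection3 : exists g r : fps int,
  f_ 1 * f_ 2 = dil 3 g * (1 - q * dil 3 r - 2%:R * (q * dil 3 r) ^+ 2) /\
  dil 3 (f_ 1 * f_ 2) = g * r.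
Proof.
have phi2 : sect 3 2 phim = 0.
  by apply: sect_theta0 => i N E; have := @sqr_mod3 i N; lia.
have psi2 : sect 3 2 psi = 0.
  apply: sect_theta0 => i N E.
  by have := @sqr_mod3 (4 * i + 1) (8 * N + 5); rewrite /triE in E; lia.
have phi0 : sect 3 0 phim = dil 3 phim.
  have -> : dil 3 phim = 1%:~R * (q ^+ 0 * dil 3 phim) by rewrite !mul1r.
  apply: (sect_hecke (p := 3) isT good_sqE hecke_phim3) => // i N E.
  have [] // := @aniso 3 1 1 isT isT i 0 N.
  by rewrite /sqE in E; lia.
have psi1 : sect 3 1 psi = dil 3 psi.
  have -> : dil 3 psi = 1%:~R * (q ^+ 0 * dil 3 psi) by rewrite !mul1r.
  apply: (sect_hecke (p := 3) isT good_triE hecke_psi3) => // i N E.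
  have [] // := @aniso 3 1 1 isT isT (triL i) 0 (8 * N + 3).
  by rewrite /triE /triL in E *; lia.
set w := sect 3 1 phim; set v := sect 3 0 psi.
have Fphi : phim = dil 3 (dil 3 phim) + q * dil 3 w.
  rewrite {1}(sect_decomp (p := 3) phim) // !big_ord_recl big_ord0 /= /bump /=.
  by rewrite phi0 phi2 rmorph0; ring.
have Fpsi : psi = dil 3 v + q * dil 3 (dil 3 psi).
  rewrite {1}(sect_decomp (p := 3) psi) // !big_ord_recl big_ord0 /= /bump /=.
  by rewrite psi1 psi2 rmorph0; ring.
set c := dil 3 (f_ 1 * f_ 2).
have cE : c = dil 3 phim * dil 3 psi by rewrite /c f1f2_phim_psi rmorphM.
have F : f_ 1 * f_ 2 = q ^+ 0 * dil 3 (dil 3 phim * v) + q ^+ 1 * dil 3 (c + w * v)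
    + q ^+ 2 * dil 3 (w * dil 3 psi).
  by rewrite f1f2_phim_psi cE {1}Fphi {1}Fpsi !rmorphD !rmorphM /=; ring.
(* Class 1 of f_1 f_2 is c + w v by the dissection and - c by [newman_f1f2_3]. *)
have wv : w * v = - 2%:R * c.
  have := newman_f1f2_3; rewrite /newman {1}F !sectD !sect_qXdil //= add0r addr0 !mul1r.
  rewrite -/c mulN1r => H; apply/eqP; rewrite -subr_eq0; apply/eqP.
  transitivity (c + w * v + c); first by ring.
  by rewrite H addNr.
set g := dil 3 phim * v in F.
have Ug : g \is a GRing.unit.
  have -> : g = sect 3 0 (f_ 1 * f_ 2).
    by rewrite F !sectD !sect_qXdil //= !addr0 mul1r.
  apply: unit_coefs0; rewrite -[LHS]/(coefs (f_ 1 * f_ 2) 0) coefsM big_ord1 /=.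
  by rewrite !big_geq // coef1.
have [r gr] : exists r, g * r = c by exists (c / g); rewrite mulrCA divrr ?mulr1.
exists g, r; split=> //.
have br : w * dil 3 psi = - 2%:R * (g * r ^+ 2).
  apply: (mulrI Ug).
  transitivity (dil 3 phim * dil 3 psi * (w * v)); first by rewrite /g; ring.
  by rewrite -cE wv -gr; ring.
rewrite F wv br.
have -> : c + - 2%:R * c = - (g * r) by rewrite gr; ring.
rewrite rmorphN /= [dil 3 (g * r)]rmorphM /= [dil 3 (- 2%:R * _)]rmorphM /=.
by rewrite [dil 3 (g * _)]rmorphM rmorphN rmorphXn rmorph_nat /=; ring.
Qed.

End Dissections.

(** * Constants read off from powers of the dissection polynomials *)

Section Instances.

Lemma newman5_2 : newman 5 2 0 (-1) (f_ 1 ^+ 2).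
Proof.
have [g [r [Ef Ed]]] := dissection5.
(* [cs] lists the coefficients of (1 - t - t^2)^2; the only index congruent to 2 modulo 5 is 2, with
   coefficient -1. *)
apply: (newman_dissection (cs := [:: 1; -2; -1; 2; 1]) _ Ef Ed) => //.
  by rewrite /= !big_cons big_nil /=; ring.
by rewrite [filter _ _]/= !big_cons big_nil /=; ring.
Qed.

Lemma newman5_3 : newman 5 3 0 (5) (f_ 1 ^+ 3).
Proof.
have [g [r [Ef Ed]]] := dissection5.
apply: (newman_dissection (cs := [:: 1; -3; 0; 5; 0; -3; -1]) _ Ef Ed) => //.
  by rewrite /= !big_cons big_nil /=; ring.
by rewrite [filter _ _]/= !big_cons big_nil /=; ring.
Qed.

Lemma newman5_4 : newman 5 4 0 (-5) (f_ 1 ^+ 4).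
Proof.
have [g [r [Ef Ed]]] := dissection5.
apply: (newman_dissection (cs := [:: 1; -4; 2; 8; -5; -8; 2; 4; 1]) _ Ef Ed) => //.
  by rewrite /= !big_cons big_nil /=; ring.
by rewrite [filter _ _]/= !big_cons big_nil /=; ring.
Qed.

Lemma newman5_8 : newman 5 3 1 (-125) (f_ 1 ^+ 8).
Proof.
have [g [r [Ef Ed]]] := dissection5.
(* The indices congruent to 3 modulo 5 are 3, 8 and 13, with coefficients 0, -125 and 0; hence u =
   1. *)
apply: (newman_dissection (cs := [:: 1; -8; 20; 0; -70; 56; 112; -120; -125; 120; 112; -56;
    -70; 0; 20; 8; 1]) _ Ef Ed) => //.
  by rewrite /= !big_cons big_nil /=; ring.
by rewrite [filter _ _]/= !big_cons big_nil /=; ring.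
Qed.

Lemma newman3_f1f2_2 : newman 3 2 0 (-3) ((f_ 1 * f_ 2) ^+ 2).
Proof.
have [g [r [Ef Ed]]] := dissection3.
apply: (newman_dissection (cs := [:: 1; -2; -3; 4; 4]) _ Ef Ed) => //.
  by rewrite /= !big_cons big_nil /=; ring.
by rewrite [filter _ _]/= !big_cons big_nil /=; ring.
Qed.

Lemma newman3_f1f2_5 : newman 3 2 1 (-81) ((f_ 1 * f_ 2) ^+ 5).
Proof.
have [g [r [Ef Ed]]] := dissection3.
(* The indices congruent to 2 modulo 3 are 2, 5 and 8, with coefficients 0, -81 and 0. *)
apply: (newman_dissection (cs := [:: 1; -5; 0; 30; -15; -81; 30; 120; 0; -80;
    -32]) _ Ef Ed) => //.
  by rewrite /= !big_cons big_nil /=; ring.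
by rewrite [filter _ _]/= !big_cons big_nil /=; ring.
Qed.

Lemma delta_newman m k r u c n : (r < m)%N -> newman m r u c (f_ 1 ^+ k) ->
  delta m k (m * n + (m * u + r)) = c * delta' m k n.
Proof.
move=> rm H; have m0 : (0 < m)%N := leq_ltn_trans (leq0n r) rm.
by have := coefs_newman n rm (unit_fX 1 k) H; rewrite rmorphXn /= dil_f1.
Qed.

Lemma delta2_newman l m k r u c n : (0 < l)%N -> (r < m)%N ->
  newman m r u c (f_ 1 ^+ k * f_ l ^+ k) ->
  delta2 l m k (m * n + (m * u + r)) = c * delta2' l m k n.
Proof.
move=> l0 rm H; have m0 : (0 < m)%N := leq_ltn_trans (leq0n r) rm.
have UF : f_ 1 ^+ k * f_ l ^+ k \is a GRing.unit by rewrite unitrM !unit_fX.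
have := coefs_newman n rm UF H.
by rewrite rmorphM !rmorphXn /= dil_f1 // dil_f // [(m * l)%N]mulnC.
Qed.

End Instances.

(* In the sixth line the index is 5n+8: the value 5n+3 fails already at n = 0,
   where the two sides are 0 and -125 (for delta m k the shift is
   k(m^2-1)/24 in every line). *)
Theorem theorem1p2 (n : nat) :
  delta 3 3 (3 * n + 1) = - 3 * delta' 3 3 n /\
  delta 3 6 (3 * n + 2) = 9 * delta' 3 6 n /\
  delta 5 2 (5 * n + 2) = - delta' 5 2 n /\
  delta 5 3 (5 * n + 3) = 5 * delta' 5 3 n /\
  delta 5 4 (5 * n + 4) = - 5 * delta' 5 4 n /\
  delta 5 8 (5 * n + 8) = - 125 * delta' 5 8 n /\
  delta 7 2 (7 * n + 4) = delta' 7 2 n /\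
  delta 7 3 (7 * n + 6) = - 7 * delta' 7 3 n /\
  delta 7 6 (7 * n + 12) = 49 * delta' 7 6 n /\
  delta 11 2 (11 * n + 10) = delta' 11 2 n /\
  delta2 2 3 1 (3 * n + 1) = - delta2' 2 3 1 n /\
  delta2 2 3 2 (3 * n + 2) = - 3 * delta2' 2 3 2 n /\
  delta2 2 3 5 (3 * n + 5) = - 81 * delta2' 2 3 5 n /\
  delta2 2 5 1 (5 * n + 3) = delta2' 2 5 1 n /\
  delta2 2 5 3 (5 * n + 9) = 25 * delta2' 2 5 3 n /\
  delta2 3 5 1 (5 * n + 4) = delta2' 3 5 1 n /\
  delta2 3 5 2 (5 * n + 8) = - 5 * delta2' 3 5 2 n /\
  delta2 3 5 3 (5 * n + 12) = 25 * delta2' 3 5 3 n /\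
  delta2 2 7 1 (7 * n + 6) = delta2' 2 7 1 n /\
  delta2 4 7 1 (7 * n + 10) = delta2' 4 7 1 n /\
  delta2 3 11 1 (11 * n + 20) = delta2' 3 11 1 n /\
  delta2 4 11 1 (11 * n + 25) = delta2' 4 11 1 n.
Proof.
(* Each shift is written m u + r with r < m. The remaining side conditions, anisotropy and the value
   of the shift, hold by evaluation. *)
split; first exact: (@delta_newman 3 3 1 0 (-3) n isT (@newman_c 3 1 0 _ _ 1 isT hecke_tri3
    isT erefl)).
(* The sixth power is a product of two cubes, that is l = 1 with the form x^2 + y^2. *)
split; first by apply: (@delta_newman 3 6 2 0 9 n isT); rewrite (exprD _ 3 3);
    exact: ((@newman_cc 3 2 0 _ _ _ 1 erefl isT isT hecke_tri3 isT erefl)).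
split; first by rewrite -mulN1r; exact: (@delta_newman 5 2 2 0 (-1) n isT newman5_2).
split; first exact: (@delta_newman 5 3 3 0 5 n isT newman5_3).
split; first exact: (@delta_newman 5 4 4 0 (-5) n isT newman5_4).
split; first exact: (@delta_newman 5 8 3 1 (-125) n isT newman5_8).
(* Again l = 1; x^2 + y^2 is anisotropic modulo 7 and, below, modulo 11. *)
split; first by rewrite -[RHS]mul1r; exact: (@delta_newman 7 2 4 0 1 n isT (@newman_ff 7 4 0
    _ _ _ 1 erefl isT isT hecke_pen7 isT erefl)).
split; first exact: (@delta_newman 7 3 6 0 (-7) n isT (@newman_c 7 6 0 _ _ 1 isT hecke_tri7
    isT erefl)).
split; first by apply: (@delta_newman 7 6 5 1 49 n isT); rewrite (exprD _ 3 3);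
    exact: ((@newman_cc 7 5 1 _ _ _ 1 erefl isT isT hecke_tri7 isT erefl)).
split; first by rewrite -[RHS]mul1r; exact: (@delta_newman 11 2 10 0 1 n isT (@newman_ff 11
    10 0 _ _ _ 1 erefl isT isT hecke_pen11 isT erefl)).
split; first by rewrite -mulN1r; exact: (@delta2_newman 2 3 1 1 0 (-1) n isT isT newman_f1f2_3).
split; first by apply: (@delta2_newman 2 3 2 2 0 (-3) n isT isT); rewrite -exprMn;
    exact: newman3_f1f2_2.
split; first by apply: (@delta2_newman 2 3 5 2 1 (-81) n isT isT); rewrite -exprMn;
    exact: newman3_f1f2_5.
split; first by rewrite -[RHS]mul1r; exact: (@delta2_newman 2 5 1 3 0 1 n isT isT (@newman_ff
    5 3 0 _ _ _ 2 erefl isT isT hecke_pen5 isT erefl)).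
split; first exact: (@delta2_newman 2 5 3 4 1 25 n isT isT (@newman_cc 5 4 1 _ _ _ 2 erefl
    isT isT hecke_tri5 isT erefl)).
split; first by rewrite -[RHS]mul1r; exact: (@delta2_newman 3 5 1 4 0 1 n isT isT (@newman_ff
    5 4 0 _ _ _ 3 erefl isT isT hecke_pen5 isT erefl)).
split; first exact: (@delta2_newman 3 5 2 3 1 (-5) n isT isT newman_f1f3_sqr).
split; first exact: (@delta2_newman 3 5 3 2 2 25 n isT isT (@newman_cc 5 2 2 _ _ _ 3 erefl
    isT isT hecke_tri5 isT erefl)).
split; first by rewrite -[RHS]mul1r; exact: (@delta2_newman 2 7 1 6 0 1 n isT isT (@newman_ff
    7 6 0 _ _ _ 2 erefl isT isT hecke_pen7 isT erefl)).
split; first by rewrite -[RHS]mul1r; exact: (@delta2_newman 4 7 1 3 1 1 n isT isT (@newman_ff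
    7 3 1 _ _ _ 4 erefl isT isT hecke_pen7 isT erefl)).
split; first by rewrite -[RHS]mul1r; exact: (@delta2_newman 3 11 1 9 1 1 n isT isT
    (@newman_ff 11 9 1 _ _ _ 3 erefl isT isT hecke_pen11 isT erefl)).
by rewrite -[RHS]mul1r; exact: (@delta2_newman 4 11 1 3 2 1 n isT isT (@newman_ff 11 3 2 _ _
    _ 4 erefl isT isT hecke_pen11 isT erefl)).
Qed.
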